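(* The operad $\mathrm{M}\mathcal{A}ss$ is Koszul.
   Context: $k$ is a field (normally $\mathbb Q$). **$\mathrm M\mathcal Ass$.** A Möbius tree is a tree with labelled legs (inputs $1,\dots,n$ and an output), a cyclic ordering of the half edges at each vertex and a colouring of half edges by $\{0,1\}$. Isomorphisms are isomorphisms of labelled trees which at each vertex either preserve the cyclic order and the colours, or reverse the cyclic order and all the colours of half edges at that vertex. $\mathrm M\mathcal Ass(n)$, $n\ge1$, is the $k$-vector space spanned by isomorphism classes of one-vertex Möbius trees with $n$ inputs; $S_n$ relabels inputs; composition glues the output of one corolla to an input of another and contracts the new edge (after reflecting a vertex if necessary so that the two half edges have the same colour; the cyclic orders merge). $\mathrm M\mathcal Ass(1)=K=\langle1,a\rangle/(a^2=1)=k[\mathbb Z_2]$. **Quadratic operads.** For a semisimple algebra $K$, a finite-dimensional $(K,K^{\otimes2})$-bimodule $E$ with compatible $S_2$-action, and an $S_3$-stable sub-bimodule $R\subset F(E)(3)$ of the free operad over $K$ (decorated reduced trees, tensor products over $K$), $\mathcal P(K,E,R)=F(E)/(R)$. $\mathrm M\mathcal Ass$ is of this form with $E=\mathrm M\mathcal Ass(2)$ and $R$ generated by the associativity relation for the corolla with all half edges coloured $0$. The quadratic dual is $\mathcal P^!=\mathcal P(K^{op},E^\vee,R^\perp)$ with $E^\vee=\mathrm{Hom}_K(E,K)\otimes\mathrm{sgn}$. **Dual dg operad and Koszulness.** For $\mathcal P$ with finite-dimensional $\mathcal P(n)$ and $\mathcal P(1)=K$, for $n\ge2$ set $C(\mathcal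 P)(n)^s=\bigoplus_{|T|=s-1}\mathcal P(T)^*\otimes\det(T)$, sum over isomorphism classes of reduced $n$-trees $T$ (all vertices of valence $\ge3$) with $|T|$ internal edges, $\mathcal P(T)=\bigotimes_v\mathcal P(\mathrm{In}(v))$ over $K$, ${}^*=\mathrm{Hom}_K(-,K)$, $\det(T)=\Lambda^{top}k^{\mathrm{Edge}(T)}$; the differential on the summand of $T'$ is the sum over $(T,e)$ with $T/e=T'$ of the dual of the composition map $\mathcal P(T)\to\mathcal P(T')$ tensored with $e\wedge-$. $\mathbf D\mathcal P=C(\mathcal P)\otimes\Lambda$ with $\Lambda(n)=k$ in degree $1-n$ with sign representation. The top non-zero degree of $\mathbf D\mathcal P(n)$ is $0$, and for $\mathcal P=\mathcal P(K,E,R)$ one has $\mathbf D\mathcal P(n)^0=F(E^\vee)(n)$, giving a morphism $\mathbf D\mathcal P\to\mathcal P^!$ by quotienting by the relations $R^\perp$. $\mathcal P$ is *Koszul* if this is a quasi-isomorphism, i.e. each $\mathbf D\mathcal P(n)$ is exact everywhere except at the right end (degree 0). *)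

(* Defs.v *)
From HB Require Import structures.
From mathcomp Require Import all_boot all_order all_algebra.
Set Implicit Arguments.
Unset Strict Implicit.
Unset Printing Implicit Defensive.
Import GRing.Theory.
Local Open Scope ring_scope.
Local Open Scope quotient_scope.

(* p identifies L with (I minus i) disjoint union J, the set of inputs left
   after grafting a J-ary operation into the input i of an I-ary one. *)
Definition splits (I J L : finType) (i : I) (p : L -> I + J) : Prop :=
  injective p /\ forall s, (s \in codom p) = (s != inl i).

(* k-linear operads in coordinate-free form: functors on finite sets of input
   labels and bijections, P(n) being op_sort 'I_n.  [op_comp sp x y] is the
   partial composition x o_i y with its inputs relabelled along p.  The laws
   are functoriality, bilinearity, equivariance, sequential and parallel
   associativity (the hypotheses say that both sides label their inputs in the
   same way), and the two unit laws.  In the theory below only non-empty label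
   sets matter, and K = P(1) is op_sort unit. *)
Record operad (k : fieldType) := Operad {
  op_sort :> finType -> lmodType k;
  op_act : forall (I J : finType) (f : I -> J),
    bijective f -> op_sort I -> op_sort J;
  op_comp : forall (I J L : finType) (i : I) (p : L -> I + J),
    splits i p -> op_sort I -> op_sort J -> op_sort L;
  op_unit : op_sort unit;
  op_act_linear : forall (I J : finType) (f : I -> J) (fB : bijective f),
    linear (op_act fB);
  op_act_id : forall (I : finType) (f : I -> I) (fB : bijective f) x,
    f =1 id -> op_act fB x = x;
  op_act_comp : forall (I J L : finType)
      (f : I -> J) (g : J -> L) (h : I -> L)
      (fB : bijective f) (gB : bijective g) (hB : bijective h) x,
    h =1 g \o f -> op_act gB (op_act fB x) = op_act hB x;
  op_comp_linearl : forall (I J L : finType) (i : I) (p : L -> I + J)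
      (sp : splits i p) y, linear (fun x => op_comp sp x y);
  op_comp_linearr : forall (I J L : finType) (i : I) (p : L -> I + J)
      (sp : splits i p) x, linear (op_comp sp x);
  op_comp_act : forall (I J L I' J' L' : finType) (i : I)
      (p : L -> I + J) (p' : L' -> I' + J')
      (f : I -> I') (g : J -> J') (h : L -> L')
      (fB : bijective f) (gB : bijective g) (hB : bijective h)
      (sp : splits i p) (sp' : splits (f i) p') x y,
    (forall l, p' (h l) = match p l with
                          | inl a => inl (f a)
                          | inr b => inr (g b)
                          end) ->
    op_comp sp' (op_act fB x) (op_act gB y) = op_act hB (op_comp sp x y);
  op_comp_seq : forall (I J L M M' N : finType) (i : I) (j : J) (m : M)
      (p : M -> I + J) (q : N -> M + L) (r : M' -> J + L) (s : N -> I + M')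
      (sp : splits i p) (sq : splits m q) (sr : splits j r) (ss : splits i s)
      x y z,
    p m = inr j ->
    (forall n, match q n with
               | inl m => match p m with
                          | inl a => inl a
                          | inr b => inr (inl b)
                          end
               | inr c => inr (inr c)
               end = match s n with
                     | inl a => inl a
                     | inr m' => inr (r m')
                     end) ->
    op_comp sq (op_comp sp x y) z = op_comp ss x (op_comp sr y z);
  op_comp_par : forall (I J L M M' N : finType) (i i' : I) (m : M) (m' : M')
      (p : M -> I + J) (q : N -> M + L) (r : M' -> I + L) (s : N -> M' + J)
      (sp : splits i p) (sq : splits m q) (sr : splits i' r) (ss : splits m' s)
      x y z,
    p m = inl i' -> r m' = inl i ->
    (forall n, match q n with
               | inl m => match p m with
                          | inl a => inl (inl a)
                          | inr b => inr b
                          end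
               | inr c => inl (inr c)
               end = match s n with
                     | inl m' => inl (r m')
                     | inr b => inr b
                     end) ->
    op_comp sq (op_comp sp x y) z = op_comp ss (op_comp sr x z) y;
  op_unitl : forall (I : finType) (s : splits tt (@inr unit I)) x,
    op_comp s op_unit x = x;
  op_unitr : forall (I : finType) (i : I)
      (s : splits i (fun a : I => if a == i then inr tt else inl a)) x,
    op_comp s x op_unit = x
}.

Section Trees.
Variable n : nat.
Implicit Types (T : {set {set 'I_n}}) (A B D : {set 'I_n}).

(* A reduced n-tree has no non-trivial automorphism and is determined up to
   isomorphism by its set of vertices when a vertex is identified with the set
   of the inputs (leaves) lying above it: a family of pairwise nested or
   disjoint subsets with at least two elements, containing the full set (the
   root vertex). *)
Definition is_tree T : bool :=
  [&& [set: 'I_n] \in T,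
      [forall A in T, 1 < #|A|]%N
    & [forall A in T, forall B in T,
         [|| A \subset B, B \subset A | [disjoint A & B]]]].

Definition nodes T : {set {set 'I_n}} := T :|: [set [set i] | i : 'I_n].

(* The incoming half edges of the vertex B come from the maximal proper
   subsets of B among the vertices and the legs (singletons). *)
Definition inputs T B : {set {set 'I_n}} :=
  [set D in nodes T | (D \proper B) &&
     [forall E in T, ~~ ((D \proper E) && (E \proper B))]].

(* An internal edge is identified with the vertex it leaves, which is any
   vertex but the root; contracting the edge e turns T into T :\ e. *)
Definition edges T : {set {set 'I_n}} := T :\ [set: 'I_n].

Lemma is_treeP T : is_tree T ->
  [/\ [set: 'I_n] \in T, forall A, A \in T -> (1 < #|A|)%N
    & forall A B, A \in T -> B \in T ->
        [\/ A \subset B, B \subset A | [disjoint A & B]]].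
Proof.
case/and3P=> h1 /forallP h2 /forallP h3; split=> // [A|A B AT BT].
  by move/implyP: (h2 A).
by move: (h3 A); rewrite AT => /forallP/(_ B); rewrite BT => /or3P.
Qed.

Lemma inputsP T B D :
  reflect [/\ D \in nodes T, D \proper B
            & forall E, E \in T -> D \proper E -> E \proper B -> False]
          (D \in inputs T B).
Proof.
rewrite [D \in inputs T B]inE; apply: (iffP idP).
  case/and3P=> h1 h2 /forallP h3; split=> // E ET DE EB.
  by move: (h3 E); rewrite ET DE EB.
case=> h1 h2 h3; apply/and3P; split=> //.
by apply/forallP => E; apply/implyP => ET; apply/negP => /andP[]; exact: h3.
Qed.

Lemma is_tree_contract T e : is_tree T -> e \in edges T -> is_tree (T :\ e).
Proof.
case/and3P=> h1 /forallP h2 /forallP h3; rewrite !inE => /andP[eN eT].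
apply/and3P; split.
- by rewrite !inE eq_sym eN.
- apply/forallP => A; apply/implyP; rewrite !inE => /andP[_ AT].
  by move: (h2 A); rewrite AT.
- apply/forallP => A; apply/implyP; rewrite !inE => /andP[_ AT].
  apply/forallP => B; apply/implyP; rewrite !inE => /andP[_ BT].
  by move: (h3 A); rewrite AT => /forallP/(_ B); rewrite BT.
Qed.

Section Contract.
Variables (T : {set {set 'I_n}}) (e : {set 'I_n}).
Hypotheses (treeT : is_tree T) (eT : e \in T).

Lemma in_inputs_contract_node D : D != e -> (D \in nodes (T :\ e)) = (D \in nodes T).
Proof. by move=> De; rewrite !inE De. Qed.

Lemma notin_inputs_contract B : e \notin inputs (T :\ e) B.
Proof.
apply/negP => /inputsP[]; rewrite !inE eqxx /= => /imsetP[i _ ei].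
by case/is_treeP: treeT => _ /(_ _ eT); rewrite ei cards1.
Qed.

Lemma inputs_contract_other B : B \in T -> B != e -> e \notin inputs T B ->
  inputs (T :\ e) B = inputs T B.
Proof.
move=> BT Be eB; apply/setP => D.
have [->|De] := eqVneq D e; first by rewrite (negbTE eB) (negbTE (notin_inputs_contract B)).
apply/inputsP/inputsP => -[]; rewrite in_inputs_contract_node // => h1 h2 h3; split=> //.
- move=> E ET DE EB; have [Ee|Ee] := eqVneq E e; last first.
    by apply: (h3 E) => //; rewrite !inE Ee.
  subst E; case/negP: eB; apply/inputsP; split=> //; first by rewrite inE eT.
  move=> E ET' eE EB'; apply: (h3 E) => //; last exact: proper_trans eE.
  by rewrite !inE ET' andbT; apply: contraTneq eE => ->; rewrite properxx.
- by move=> E; rewrite !inE => /andP[_]; exact: h3.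
Qed.

Lemma inputs_contract_parent B D : e \in inputs T B ->
  (D \in inputs (T :\ e) B) =
  (D != e) && (D \in inputs T B) || (D \in inputs T e).
Proof.
case/is_treeP: treeT => tT tcard tlam /inputsP[_ eB emax].
have nodeN0 A : A \in nodes T -> exists i, i \in A.
  rewrite inE => /orP[/tcard c|/imsetP[i _ ->]]; last by exists i; rewrite set11.
  by apply/set0Pn; rewrite -card_gt0 (ltn_trans _ c).
have [->|De] /= := eqVneq D e.
  rewrite (negbTE (notin_inputs_contract B)); apply/esym/negP.
  by case/inputsP=> _ + _; rewrite properxx.
apply/idP/orP => [/inputsP[]|[]/inputsP[]].
- rewrite in_inputs_contract_node // => h1 h2 h3.
  have [DpE|DpE] := boolP (D \proper e); [right|left]; apply/inputsP; split=> //.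
    move=> E ET DE Ee; apply: (h3 E) => //; last exact: proper_trans eB.
    by rewrite !inE ET andbT; apply: contraTneq Ee => ->; rewrite properxx.
  move=> E ET DE EB; apply: (h3 E) => //; rewrite !inE ET andbT.
  by apply: contraNneq DpE => <-.
- move=> h1 h2 h3; apply/inputsP; rewrite in_inputs_contract_node //; split=> //.
  by move=> E; rewrite !inE => /andP[_]; exact: h3.
- move=> h1 h2 h3; apply/inputsP; rewrite in_inputs_contract_node //; split=> //.
    exact: proper_trans eB.
  move=> E; rewrite !inE => /andP[Ee ET] DE EB.
  case: (tlam E e ET eT) => [Ee'|eE|dis].
  + by apply: (h3 E) => //; rewrite properEneq Ee.
  + by apply: (emax E) => //; rewrite properEneq eq_sym Ee.
  + have [i iD] := nodeN0 _ h1; move/pred0P/(_ i): dis => /=.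
    by rewrite (subsetP (proper_sub DE) _ iD) (subsetP (proper_sub h2) _ iD).
Qed.

Lemma inputs_disjoint B : e \in inputs T B -> [disjoint inputs T B & inputs T e].
Proof.
case/inputsP => _ eB _; apply/pred0P => D /=; apply/negP => /andP[/inputsP[_ _ h] /inputsP[_ De _]].
exact: h De eB.
Qed.

End Contract.
End Trees.

Section TreeTypes.
Variable n : nat.

Definition tree : finType := {T : {set {set 'I_n}} | is_tree T}.
Definition vertex (T : tree) : finType := {B : {set 'I_n} | B \in val T}.
Definition edge (T : tree) : finType := {A : {set 'I_n} | A \in edges (val T)}.
Definition input (T : tree) (v : vertex T) : finType :=
  {D : {set 'I_n} | D \in inputs (val T) (val v)}.

Definition root_vertex (T : tree) : vertex T :=
  Sub [set: 'I_n] (let: And3 h _ _ := is_treeP (valP T) in h).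

Definition edge_source (T : tree) (e : edge T) : vertex T :=
  Sub (val e) (subsetP (subD1set _ _) _ (valP e)).

Definition contract_tree (T : tree) (e : edge T) : tree :=
  Sub (val T :\ val e) (is_tree_contract (valP T) (valP e)).

Variables (T : tree) (e : edge T).

Definition lift_vertex (v : vertex (contract_tree e)) : vertex T :=
  Sub (val v) (subsetP (subD1set _ _) _ (valP v)).

Variable v : vertex (contract_tree e).

Section Parent.
Hypothesis ev : val e \in inputs (val T) (val (lift_vertex v)).

Definition parent_input : input (lift_vertex v) := Sub (val e) ev.

Definition split_input (D : input v) :
    input (lift_vertex v) + input (edge_source e) :=
  if insub (val D) is Some D' then inr D' else inl (insubd parent_input (val D)).

Lemma mem_input_contract (D : {set 'I_n}) :
  (D \in inputs (val T :\ val e) (val v)) =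
  (D != val e) && (D \in inputs (val T) (val v)) || (D \in inputs (val T) (val e)).
Proof. exact: inputs_contract_parent (valP T) (valP (edge_source e)) _ _ ev. Qed.

Lemma split_input_splits : splits parent_input split_input.
Proof.
have E (D : input v) : val D = match split_input D with
    | inl a => val a | inr b => val b end.
  rewrite /split_input; case: insubP => [b _ -> //|] /= nD.
  rewrite val_insubd; case: ifP => // /negP[].
  by have := valP D; rewrite /= mem_input_contract (negbTE nD) orbF => /andP[].
split=> [D D' DD'|s]; first by apply: val_inj; rewrite !E DD'.
apply/codomP/idP => [[D ->]|].
  apply/eqP => DE; have := valP D; rewrite E DE /= mem_input_contract eqxx /=.
  by case/inputsP=> _; rewrite properxx.
have dis D : D \in inputs (val T) (val (lift_vertex v)) ->
    D \in inputs (val T) (val e) -> False.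
  by move=> h1 h2; move/pred0P/(_ D): (inputs_disjoint (valP (edge_source e)) ev); rewrite /= h1 h2.
case: s => [a|b] sN.
  have aE : val a != val e.
    by apply: contraNneq sN => ae; apply/eqP; congr inl; apply: val_inj.
  have h : val a \in inputs (val T :\ val e) (val v).
    by rewrite mem_input_contract aE (valP a).
  exists (Sub (val a) h); rewrite /split_input /=; case: insubP => [d hd _|_].
    by case: (dis _ (valP a) hd).
  by congr inl; apply: val_inj; rewrite val_insubd /= (valP a).
have h : val b \in inputs (val T :\ val e) (val v).
  by rewrite mem_input_contract (valP b) orbT.
by exists (Sub (val b) h); rewrite /split_input /= valK.
Qed.

End Parent.

Section Other.
Hypothesis ev : val e \notin inputs (val T) (val (lift_vertex v)).

Lemma input_contract_other :
  inputs (val T :\ val e) (val v) = inputs (val T) (val (lift_vertex v)).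
Proof.
apply: inputs_contract_other ev; [exact: valP T | exact: (valP (edge_source e))
  | exact: (valP (lift_vertex v)) | ].
by have := valP v; rewrite !inE => /andP[].
Qed.

Definition push_input (D : input (lift_vertex v)) : input v :=
  Sub (val D) (etrans (congr1 (fun X : {set {set 'I_n}} => val D \in X)
                              input_contract_other) (valP D)).

Lemma push_input_bij : bijective push_input.
Proof.
pose g (D : input v) : input (lift_vertex v) :=
  Sub (val D) (etrans (congr1 (fun X : {set {set 'I_n}} => val D \in X)
                              (esym input_contract_other)) (valP D)).
by exists g => D; apply: val_inj.
Qed.

End Other.
End TreeTypes.

Section DualDg.
Variables (k : fieldType) (P : operad k).

Local Notation K := (P unit).

Lemma outer_splits (I : finType) : splits tt (@inr unit I).
Proof.
split=> [a b [->] //|s]; apply/codomP/idP => [[a ->]//|].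
by case: s => [[]|a] // _; exists a.
Qed.

Lemma inner_splits (I : finType) (i : I) :
  splits i (fun a : I => if a == i then inr tt else inl a).
Proof.
split=> [a b|s]; first by case: (a =P i) => [->|_]; case: (b =P i) => [->|_] // [->].
apply/codomP/idP => [[a ->]|].
  by have [//|an] := eqVneq a i; apply/eqP => -[ai]; rewrite ai eqxx in an.
case: s => [a|[]] ai; last by exists i; rewrite eqxx.
by exists a; have [e|//] := eqVneq a i; rewrite e eqxx in ai.
Qed.

Definition left_act (I : finType) (c : K) (x : P I) : P I :=
  op_comp (outer_splits I) c x.

Definition right_act (I : finType) (i : I) (x : P I) (c : K) : P I :=
  op_comp (inner_splits i) x c.

Variable n : nat.

(* P(T) is the tensor product over K of the P(In(v)); by its universal
   property, Hom_K(P(T), K) is the set of the functions of a decoration which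
   satisfy in_dual: k-multilinear, K-balanced along every internal edge (w is
   the vertex above v) and linear for the left action of K at the root. *)
Definition decoration (T : tree n) : Type := forall v : vertex T, P (input v).

Definition redecorate (T : tree n) (x : decoration T) (v : vertex T)
    (y : P (input v)) : decoration T :=
  @dfwith _ (fun v => P (input v)) x v y.

(* The composition map P(T) -> P(T/e): the two ends of e are composed, and
   at the other vertices nothing changes except the type of the labels. *)
Definition contract (T : tree n) (e : edge T) (x : decoration T) :
    decoration (contract_tree e) := fun v =>
  match boolP (val e \in inputs (val T) (val (lift_vertex v))) with
  | AltTrue ev =>
      op_comp (split_input_splits ev) (x (lift_vertex v)) (x (edge_source e))
  | AltFalse ev => op_act (push_input_bij ev) (x (lift_vertex v))
  end.

Arguments contract {T} e x.

Definition in_dual (T : tree n) (phi : decoration T -> K) : Prop :=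
  [/\ forall (x : decoration T) (v : vertex T),
        linear (fun y : P (input v) => phi (redecorate x y)),
      forall (x : decoration T) (v w : vertex T)
             (wv : val w \in inputs (val T) (val v)) (c : K),
        phi (redecorate x (right_act (Sub (val w) wv : input v) (x v) c)) =
        phi (redecorate x (left_act c (x w)))
    & forall (x : decoration T) (c : K),
        phi (redecorate x (left_act c (x (root_vertex T)))) =
        left_act c (phi x)].

Definition cochain : Type := forall T : tree n, decoration T -> K.

(* A cochain lists one element of P(T)^* for each tree T.  The line det(T) is
   trivialized by the basis vector e_1 /\ ... /\ e_m, where e_1, ..., e_m is
   the enumeration of the internal edges; since removing an edge preserves the
   enumeration order, e /\ - is the sign (-1)^index in dC. *)
Definition in_C (s : int) (phi : cochain) : Prop :=
  forall T : tree n, in_dual (phi T) /\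
    ((#|edges (val T)|%:Z != s - 1) -> forall x, phi T x = 0).

Definition dC (phi : cochain) : cochain := fun T x =>
  \sum_(e : edge T) (-1) ^+ index (val e) (enum (edges (val T))) *:
    phi (contract_tree e) (contract e x).

Arguments dC phi T x : clear implicits.

(* Tensoring with Lambda(n), one-dimensional in degree 1 - n, only shifts the
   degree as far as the complex D(P)(n) of vector spaces is concerned: the
   factor sgn only affects the action of S_n. *)
Definition in_D (j : int) : cochain -> Prop := in_C (j - (1 - n%:Z)).

Definition exact_at (j : int) : Prop :=
  forall phi, in_D j phi -> (forall T x, dC phi T x = 0) ->
  exists psi, in_D (j - 1) psi /\ forall T x, dC psi T x = phi T x.

End DualDg.

(* The top degree of D(P)(n) is 0.  The complex for n = 1 is K in degree 0. *)
Definition koszul (k : fieldType) (P : operad k) : Prop :=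
  forall (n : nat) (j : int), (2 <= n)%N -> j != 0 -> exact_at P n j.

(* A cyclic order as a ternary relation: (a, b, c) \in R means that, starting
   from a, one meets b before c. *)
Definition cyclic_order (H : finType) (R : {set H * H * H}) : bool :=
  [&& [forall a, forall b, forall c, ((a, b, c) \in R) ==> ((b, c, a) \in R)],
      [forall a, forall b, forall c, ((a, b, c) \in R) ==> ((c, b, a) \notin R)],
      [forall a, forall b, forall c, forall d,
         ((a, b, c) \in R) && ((a, c, d) \in R) ==> ((a, b, d) \in R)]
    & [forall a, forall b, forall c, [&& a != b, b != c & a != c] ==>
         ((a, b, c) \in R) || ((c, b, a) \in R)]].

Section CyclicOrder.
Variable H : finType.
Implicit Types R : {set H * H * H}.

Lemma cyclic_orderP R :
  reflect [/\ forall a b c, (a, b, c) \in R -> (b, c, a) \in R,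
              forall a b c, (a, b, c) \in R -> (c, b, a) \notin R,
              forall a b c d, (a, b, c) \in R -> (a, c, d) \in R ->
                (a, b, d) \in R
            & forall a b c, a != b -> b != c -> a != c ->
                ((a, b, c) \in R) || ((c, b, a) \in R)]
          (cyclic_order R).
Proof.
apply: (iffP and4P) => -[h1 h2 h3 h4]; split.
- by move=> a b c; move/forallP/(_ a)/forallP/(_ b)/forallP/(_ c)/implyP: h1.
- by move=> a b c; move/forallP/(_ a)/forallP/(_ b)/forallP/(_ c)/implyP: h2.
- move=> a b c d r1 r2.
  move/forallP/(_ a)/forallP/(_ b)/forallP/(_ c)/forallP/(_ d)/implyP: h3.
  by apply; rewrite r1.
- move=> a b c n1 n2 n3.
  move/forallP/(_ a)/forallP/(_ b)/forallP/(_ c)/implyP: h4; apply.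
  by rewrite n1 n2.
- do 3!apply/forallP => ?; apply/implyP; exact: h1.
- do 3!apply/forallP => ?; apply/implyP; exact: h2.
- by do 4!apply/forallP => ?; apply/implyP => /andP[]; exact: h3.
- do 3!apply/forallP => ?; apply/implyP => /and3P[]; exact: h4.
Qed.

Lemma cyclic_irr R : cyclic_order R ->
  forall a b c, (a, b, c) \in R -> [/\ a != b, b != c & a != c].
Proof.
move=> /cyclic_orderP[h1 h2 _ _].
have K a b : (a, a, b) \notin R.
  apply/negP => r; have /negP[] := h2 _ _ _ (h1 _ _ _ r).
  exact: (h1 _ _ _ r).
move=> a b c r; split; apply/eqP => e; subst.
- by move: r; apply/negP/K.
- by move/h1: r; apply/negP/K.
- by move/h1/h1: r; apply/negP/K.
Qed.

End CyclicOrder.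

Definition pull_order (H X : finType) (f : H -> X) (R : {set X * X * X}) :=
  [set t : H * H * H | (f t.1.1, f t.1.2, f t.2) \in R].

Lemma pull_order_cyclic (H X : finType) (f : H -> X) R :
  injective f -> cyclic_order R -> cyclic_order (pull_order f R).
Proof.
move=> fI /cyclic_orderP[h1 h2 h3 h4]; apply/cyclic_orderP; split.
- by move=> a b c; rewrite !inE; exact: h1.
- by move=> a b c; rewrite !inE; exact: h2.
- by move=> a b c d; rewrite !inE; exact: h3.
- move=> a b c; rewrite !inE /= -!(inj_eq fI); exact: h4.
Qed.

Section Merge.
Variables (H X Y : finType) (f : H -> X) (g : H -> Y) (x0 : X) (y0 : Y).
Variables (RX : {set X * X * X}) (RY : {set Y * Y * Y}).
Hypotheses (cX : cyclic_order RX) (cY : cyclic_order RY).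
Hypothesis sideE : forall h, (g h == y0) = (f h != x0).
Hypothesis fgI : forall h h', f h = f h' -> g h = g h' -> h = h'.

Let side h : g h = y0 \/ f h = x0.
Proof. by have [->|n] := eqVneq (f h) x0; [right | left; apply/eqP; rewrite sideE]. Qed.

Let irX a b : [/\ (a, a, b) \notin RX, (a, b, b) \notin RX & (a, b, a) \notin RX].
Proof.
by split; apply/negP => /(cyclic_irr cX)[]; rewrite ?eqxx.
Qed.
Let irY a b : [/\ (a, a, b) \notin RY, (a, b, b) \notin RY & (a, b, a) \notin RY].
Proof.
by split; apply/negP => /(cyclic_irr cY)[]; rewrite ?eqxx.
Qed.

Lemma merge_cyclic : cyclic_order (pull_order f RX :|: pull_order g RY).
Proof.
have irX1 a b := negbTE (let: And3 h _ _ := irX a b in h).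
have irX2 a b := negbTE (let: And3 _ h _ := irX a b in h).
have irX3 a b := negbTE (let: And3 _ _ h := irX a b in h).
have irY1 a b := negbTE (let: And3 h _ _ := irY a b in h).
have irY2 a b := negbTE (let: And3 _ h _ := irY a b in h).
have irY3 a b := negbTE (let: And3 _ _ h := irY a b in h).
pose ir := (irX1, irX2, irX3, irY1, irY2, irY3).
case/cyclic_orderP: cX => x1 x2 x3 x4.
case/cyclic_orderP: cY => y1 y2 y3 y4.
apply/cyclic_orderP; split.
- by move=> a b c; rewrite !inE /= => /orP[/x1->|/y1->]; rewrite ?orbT.
- move=> a b c; rewrite !inE /= negb_or.
  by case: (side a) => ->; case: (side b) => ->; case: (side c) => ->;
    rewrite !ir ?orbF ?andbT //=; auto.
- move=> a b c d; rewrite !inE /=.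
  by case: (side a) => ea; case: (side b) => eb; case: (side c) => ec;
    case: (side d) => ed; rewrite ?ea ?eb ?ec ?ed !ir ?orbF /= => r1 r2;
    eauto; move: r1 r2 (x3 (f a) (f b) (f c) (f d)) (y3 (g a) (g b) (g c) (g d));
    rewrite ?ea ?eb ?ec ?ed ?ir //; auto => -> ->; rewrite ?orbT //.
- have N u v : u != v -> g u = g v -> f u != f v.
    by move=> uv guv; apply: contraNneq uv => fuv; rewrite (fgI fuv guv).
  have M u v : u != v -> f u = f v -> g u != g v.
    by move=> uv fuv; apply: contraNneq uv => guv; rewrite (fgI fuv guv).
  have XY u v : g u = y0 -> f v = x0 -> (f u != f v) /\ (g u != g v).
    move=> gu fv; split.
      by apply/eqP => fuv; move: (sideE u); rewrite gu fuv fv !eqxx.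
    by apply/eqP => guv; move: (sideE v); rewrite -guv gu fv !eqxx.
  have YX u v : f u = x0 -> g v = y0 -> (f u != f v) /\ (g u != g v).
    by move=> fu gv; rewrite eq_sym [g u == _]eq_sym; exact: XY.
  have XX u v : u != v -> g u = y0 -> g v = y0 -> f u != f v.
    by move=> uv gu gv; apply: N; rewrite // gu.
  have YY u v : u != v -> f u = x0 -> f v = x0 -> g u != g v.
    by move=> uv fu fv; apply: M; rewrite // fu.
  move=> a b c ab bc ac; rewrite !inE /=.
  suff [[h1 [h2 h3]]|[h1 [h2 h3]]] :
      (f a != f b /\ f b != f c /\ f a != f c) \/
      (g a != g b /\ g b != g c /\ g a != g c).
  + by case/orP: (x4 _ _ _ h1 h2 h3) => ->; rewrite ?orbT.
  + by case/orP: (y4 _ _ _ h1 h2 h3) => ->; rewrite ?orbT.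
  case: (side a) => ea; case: (side b) => eb; case: (side c) => ec;
  by [left; do ?split; solve [by apply: XX | by case: (XY _ _ ea ec) | by case: (YX _ _ ea ec)
       | by case: (XY _ _ ea eb) | by case: (YX _ _ ea eb)
       | by case: (XY _ _ eb ec) | by case: (YX _ _ eb ec)]
     | right; do ?split; solve [by apply: YY | by case: (XY _ _ ea ec) | by case: (YX _ _ ea ec)
       | by case: (XY _ _ ea eb) | by case: (YX _ _ ea eb)
       | by case: (XY _ _ eb ec) | by case: (YX _ _ eb ec)]].
Qed.
End Merge.

Section Corolla.
Variable I : finType.

(* One-vertex Moebius trees with inputs labelled by I: the half edges are the
   Some i and the output None; the two components are the cyclic order and the
   colouring. *)
Definition corolla : finType :=
  {x : {set option I * option I * option I} * {ffun option I -> bool}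
  | cyclic_order x.1}.

Implicit Types x y : corolla.

Definition cyc x := (val x).1.
Definition col x := (val x).2.

Lemma corolla_eq x y : cyc x = cyc y -> col x =1 col y -> x = y.
Proof.
case: x y => [[c d] h] [[c' d'] h'] /= e /ffunP e'; apply: val_inj => /=.
by move: e e'; rewrite /cyc /col /= => -> ->.
Qed.

Definition reverse_order (H : finType) (R : {set H * H * H}) :=
  [set t : H * H * H | (t.2, t.1.2, t.1.1) \in R].

Lemma reverse_order_cyclic (H : finType) (R : {set H * H * H}) :
  cyclic_order R -> cyclic_order (reverse_order R).
Proof.
case/cyclic_orderP => h1 h2 h3 h4; apply/cyclic_orderP; split.
- by move=> a b c; rewrite !inE /= => /h1/h1.
- by move=> a b c; rewrite !inE /=; exact: h2.
- move=> a b c d; rewrite !inE /= => r1 r2.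
  exact: h1 _ _ _ (h3 _ _ c _ (h1 _ _ _ (h1 _ _ _ r2)) (h1 _ _ _ (h1 _ _ _ r1))).
- move=> a b c ab bc ac; rewrite !inE /= orbC; exact: h4.
Qed.

Definition reflect_corolla x : corolla :=
  Sub (reverse_order (cyc x), [ffun h => ~~ col x h])
      (reverse_order_cyclic (valP x)).

Lemma reflect_corollaK : involutive reflect_corolla.
Proof.
move=> x; apply: corolla_eq => [|h]; last by rewrite /col !ffunE negbK.
by apply/setP => -[[a b] c]; rewrite /cyc !inE.
Qed.

(* An isomorphism of labelled corollas is the identity on half edges, and it
   may reverse the order and all the colours. *)
Definition corolla_iso x y : bool := (x == y) || (x == reflect_corolla y).

Lemma corolla_iso_equiv : equiv_class_of corolla_iso.
Proof.
split=> [x|x y|y x z].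
- by rewrite /corolla_iso eqxx.
- by rewrite /corolla_iso eq_sym -(inv_eq reflect_corollaK) [X in _ || X]eq_sym.
- rewrite /corolla_iso => /orP[/eqP->//|/eqP->].
  by case/orP=> /eqP->; rewrite ?reflect_corollaK eqxx ?orbT.
Qed.

Canonical corolla_equiv := EquivRelPack corolla_iso_equiv.

Definition moebius : finType := quot_type {eq_quot corolla_equiv}.
Definition moebius_class (x : corolla) : moebius :=
  \pi_({eq_quot corolla_equiv}) x.
Definition moebius_repr (w : moebius) : corolla :=
  repr (w : {eq_quot corolla_equiv}).

Lemma moebius_reprK w : moebius_class (moebius_repr w) = w.
Proof. exact: (@reprK _ {eq_quot corolla_equiv}). Qed.

Lemma moebius_classP x y :
  reflect (moebius_class x = moebius_class y) (corolla_iso x y).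
Proof. exact: (@eqmodP _ corolla_equiv x y). Qed.

Lemma moebius_repr_iso x : corolla_iso (moebius_repr (moebius_class x)) x.
Proof. by apply/moebius_classP; rewrite moebius_reprK. Qed.

Lemma moebius_class_reflect x :
  moebius_class (reflect_corolla x) = moebius_class x.
Proof. by apply/moebius_classP; rewrite /corolla_iso eqxx orbT. Qed.

End Corolla.

Section Glue.
Variables (I J L : finType) (i : I) (p : L -> I + J).
Hypothesis sp : splits i p.

(* The half edges of the glued corolla seen from either vertex: everything
   beyond the contracted edge is sent to the half edge of that edge. *)
Definition proj_outer (h : option L) : option I :=
  if h is Some l then
    match p l with inl a => Some a | inr _ => Some i end
  else None.

Definition proj_inner (h : option L) : option J :=
  if h is Some l then
    match p l with inl _ => None | inr b => Some b end
  else None.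

Definition match_colour (x : corolla I) (y : corolla J) : corolla J :=
  if col x (Some i) == col y None then y else reflect_corolla y.

(* Merging of two cyclic orders: a triple is in order if it is so as seen from
   one of the two vertices (it is degenerate as seen from the other one). *)
Definition glue_order (x : corolla I) (y : corolla J) :=
  pull_order proj_outer (cyc x) :|: pull_order proj_inner (cyc y).

Lemma splits_neq l : p l != inl i.
Proof. by case: sp => _ <-; exact: codom_f. Qed.

Lemma glue_order_cyclic x y : cyclic_order (glue_order x y).
Proof.
apply: (merge_cyclic (x0 := Some i) (y0 := None) (valP x) (valP y)).
- case=> [l|//]; have := splits_neq l; rewrite /=.
  by case: (p l) => [a|b] /= n; rewrite ?eqxx //; apply/esym; apply: contraNneq n => -[->].
- case: sp => pI _ [l|] [l'|] //=; [|by case: (p l)|by case: (p l')].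
  case e : (p l) => [a|b]; case e' : (p l') => [a'|b'] //.
  + by case=> aa _; congr (Some _); apply: pI; rewrite e e' aa.
  + by move=> _ [bb]; congr (Some _); apply: pI; rewrite e e' bb.
Qed.

Definition glue (x : corolla I) (y : corolla J) : corolla L :=
  let y' := match_colour x y in
  Sub (glue_order x y',
       [ffun h => if h is Some l then
                    match p l with
                    | inl a => col x (Some a)
                    | inr b => col y' (Some b)
                    end
                  else col x None])
      (glue_order_cyclic x y').

Lemma mem_glue x y a b c : ((a, b, c) \in cyc (glue x y)) =
  ((proj_outer a, proj_outer b, proj_outer c) \in cyc x) ||
  ((proj_inner a, proj_inner b, proj_inner c) \in cyc (match_colour x y)).
Proof. by rewrite /cyc /= !inE. Qed.

Lemma col_glue x y h : col (glue x y) h =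
  if h is Some l then
    match p l with
    | inl a => col x (Some a)
    | inr b => col (match_colour x y) (Some b)
    end
  else col x None.
Proof. by rewrite {1}/col /= ffunE. Qed.

End Glue.

Lemma mem_reflect I (x : corolla I) a b c :
  ((a, b, c) \in cyc (reflect_corolla x)) = ((c, b, a) \in cyc x).
Proof. by rewrite /cyc /= !inE. Qed.

Lemma col_reflect I (x : corolla I) h : col (reflect_corolla x) h = ~~ col x h.
Proof. by rewrite {1}/col /= ffunE. Qed.

Section GlueReflect.
Variables (I J L : finType) (i : I) (p : L -> I + J) (sp : splits i p).

Lemma match_reflectl x (y : corolla J) :
  match_colour i (reflect_corolla x) y = reflect_corolla (match_colour i x y).
Proof.
rewrite /match_colour col_reflect.
by case: (col x _); case: (col y _) => //=; rewrite reflect_corollaK.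
Qed.

Lemma match_reflectr x (y : corolla J) :
  match_colour i x (reflect_corolla y) = match_colour i x y.
Proof.
rewrite /match_colour col_reflect.
by case: (col x _); case: (col y _) => //=; rewrite reflect_corollaK.
Qed.

Lemma glue_reflectl x y :
  glue sp (reflect_corolla x) y = reflect_corolla (glue sp x y).
Proof.
apply: corolla_eq => [|h].
  by apply/setP => -[[a b] c]; rewrite mem_reflect !mem_glue match_reflectl !mem_reflect.
rewrite col_reflect !col_glue match_reflectl.
by case: h => [l|]; rewrite ?col_reflect //; case: (p l) => ?; rewrite ?col_reflect.
Qed.

Lemma glue_reflectr x y : glue sp x (reflect_corolla y) = glue sp x y.
Proof.
apply: corolla_eq => [|h].
  by apply/setP => -[[a b] c]; rewrite !mem_glue match_reflectr.
by rewrite !col_glue match_reflectr.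
Qed.

End GlueReflect.

Lemma match_glue (I J L M : finType) (i : I) (j : J) (p : M -> J + L)
    (sp : splits j p) x y z :
  match_colour i x (glue sp y z) = glue sp (match_colour i x y) z.
Proof.
rewrite {1}/match_colour col_glue /match_colour; case: ifP => _ //.
by rewrite glue_reflectl.
Qed.

Section GlueAssoc.
Variables (I J L M M' N : finType).

Lemma glue_seq_assoc (i : I) (j : J) (m : M)
    (p : M -> I + J) (q : N -> M + L) (r : M' -> J + L) (s : N -> I + M')
    (sp : splits i p) (sq : splits m q) (sr : splits j r) (ss : splits i s) :
  p m = inr j ->
  (forall n, match q n with
             | inl m => match p m with
                        | inl a => inl a
                        | inr b => inr (inl b)
                        end
             | inr c => inr (inr c)
             end = match s n with
                   | inl a => inl a
                   | inr m' => inr (r m')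
                   end) ->
  forall x y z, glue sq (glue sp x y) z = glue ss x (glue sr y z).
Proof.
move=> pm H x y z.
have E1 h : proj_outer i p (proj_outer m q h) = proj_outer i s h.
  case: h => [n|//]; move: (H n) => /=.
  case: (q n) => [m1|l] /=; last by rewrite pm; case: (s n).
  by case: (p m1) => ?; case: (s n) => ? // [->].
have E2 h : proj_inner p (proj_outer m q h) = proj_outer j r (proj_inner s h).
  case: h => [n|//]; move: (H n) => /=.
  case: (q n) => [m1|l] /=; last first.
    by rewrite pm; case: (s n) => // m' /=; case: (r m').
  case: (p m1) => ?; case: (s n) => ? //= [].
  by case: (r _) => // ? [->].
have E3 h : proj_inner q h = proj_inner r (proj_inner s h).
  case: h => [n|//]; move: (H n) => /=.
  case: (q n) => [m1|l] /=.
    by case: (p m1) => ?; case: (s n) => //= ? [<-].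
  by case: (s n) => //= m' [<-].
have Ez : match_colour m (glue sp x y) z =
          match_colour j (match_colour i x y) z.
  by rewrite {1}/match_colour col_glue pm.
apply: corolla_eq => [|h].
  apply/setP => -[[a b] c]; rewrite !mem_glue match_glue mem_glue Ez orbA.
  by rewrite !E1 !E2 !E3.
rewrite !col_glue match_glue Ez.
case: h => [n|]; last by rewrite ?col_glue.
move: (H n).
case: (q n) => [m1|l].
  rewrite col_glue; case: (p m1) => ?; case: (s n) => ? // [] e.
    by rewrite e.
  by rewrite col_glue -e.
by case: (s n) => // m' []; rewrite col_glue => <-.
Qed.

Lemma glue_par_assoc (i i' : I) (m : M) (m' : M')
    (p : M -> I + J) (q : N -> M + L) (r : M' -> I + L) (s : N -> M' + J)
    (sp : splits i p) (sq : splits m q) (sr : splits i' r) (ss : splits m' s) :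
  p m = inl i' -> r m' = inl i ->
  (forall n, match q n with
             | inl m => match p m with
                        | inl a => inl (inl a)
                        | inr b => inr b
                        end
             | inr c => inl (inr c)
             end = match s n with
                   | inl m' => inl (r m')
                   | inr b => inr b
                   end) ->
  forall x y z, glue sq (glue sp x y) z = glue ss (glue sr x z) y.
Proof.
move=> pm rm H x y z.
have E1 h : proj_outer i p (proj_outer m q h) = proj_outer i' r (proj_outer m' s h).
  case: h => [n|//]; move: (H n) => /=.
  case: (q n) => [m1|l] /=; last first.
    by rewrite pm; case: (s n) => //= m2 [<-].
  by case: (p m1) => ?; case: (s n) => //= ? [e]; rewrite -?e ?rm ?e.
have E2 h : proj_inner p (proj_outer m q h) = proj_inner s h.
  case: h => [n|//]; move: (H n) => /=.
  case: (q n) => [m1|l] /=; last by rewrite pm; case: (s n).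
  by case: (p m1) => ?; case: (s n) => //= ? [->].
have E3 h : proj_inner q h = proj_inner r (proj_outer m' s h).
  case: h => [n|//]; move: (H n) => /=.
  case: (q n) => [m1|l] /=.
    by case: (p m1) => ?; case: (s n) => //= ? [e]; rewrite -?e ?rm ?e.
  by case: (s n) => //= ? [<-].
have Ez : match_colour m (glue sp x y) z = match_colour i' x z.
  by rewrite {1}/match_colour col_glue pm.
have Ey : match_colour m' (glue sr x z) y = match_colour i x y.
  by rewrite {1}/match_colour col_glue rm.
apply: corolla_eq => [|h].
  apply/setP => -[[a b] c]; rewrite !mem_glue Ey Ez orbAC.
  by rewrite !E1 !E2 !E3.
rewrite !col_glue Ey Ez.
case: h => [n|]; last by rewrite ?col_glue.
move: (H n); case: (q n) => [m1|l].
  rewrite col_glue; case: (p m1) => ?; case: (s n) => ? // [] e.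
    by rewrite col_glue -e.
  by rewrite e.
by case: (s n) => // m2 []; rewrite col_glue => <-.
Qed.

End GlueAssoc.

Section Pull.
Variables (I J : finType) (f : I -> J).
Hypothesis fI : injective f.

Lemma omap_inj : injective (omap f).
Proof. by case=> [a|] [b|] //= [/fI->]. Qed.

Definition pull_corolla (x : corolla J) : corolla I :=
  Sub (pull_order (omap f) (cyc x), [ffun h => col x (omap f h)])
      (pull_order_cyclic omap_inj (valP x)).

Lemma mem_pull x a b c : ((a, b, c) \in cyc (pull_corolla x)) =
  ((omap f a, omap f b, omap f c) \in cyc x).
Proof. by rewrite /cyc /= !inE. Qed.

Lemma col_pull x h : col (pull_corolla x) h = col x (omap f h).
Proof. by rewrite {1}/col /= ffunE. Qed.

Lemma pull_reflect x :
  pull_corolla (reflect_corolla x) = reflect_corolla (pull_corolla x).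
Proof.
apply: corolla_eq => [|h]; last by rewrite !(col_pull, col_reflect).
by apply/setP => -[[a b] c]; rewrite !(mem_pull, mem_reflect).
Qed.

End Pull.

Lemma pull_id (I : finType) (f : I -> I) (fI : injective f) x : f =1 id -> pull_corolla fI x = x.
Proof.
move=> fid; have E : omap f =1 id by case=> [a|] //=; rewrite fid.
apply: corolla_eq => [|h]; last by rewrite col_pull E.
by apply/setP => -[[a b] c]; rewrite mem_pull !E.
Qed.

Lemma pull_comp (I J L : finType) (f : I -> J) (g : J -> L) (h : I -> L)
  (fI : injective f) (gI : injective g) (hI : injective h) x :
  h =1 g \o f -> pull_corolla fI (pull_corolla gI x) = pull_corolla hI x.
Proof.
move=> hE; have E o : omap g (omap f o) = omap h o by case: o => [a|] //=; rewrite hE.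
apply: corolla_eq => [|o]; last by rewrite !col_pull E.
by apply/setP => -[[a b] c]; rewrite !mem_pull !E.
Qed.

Lemma pull_glue (I J L I' J' L' : finType) (i : I)
    (p : L -> I + J) (p' : L' -> I' + J') (f : I -> I') (g : J -> J') (h : L -> L')
    (sp : splits i p) (sp' : splits (f i) p')
    (fI : injective f) (gI : injective g) (hI : injective h) x y :
  (forall l, p' (h l) = match p l with inl a => inl (f a) | inr b => inr (g b) end) ->
  pull_corolla hI (glue sp' x y) = glue sp (pull_corolla fI x) (pull_corolla gI y).
Proof.
move=> H.
have M : match_colour i (pull_corolla fI x) (pull_corolla gI y) =
         pull_corolla gI (match_colour (f i) x y).
  by rewrite /match_colour !col_pull /=; case: ifP => _; rewrite ?pull_reflect.
have E1 o : proj_outer (f i) p' (omap h o) = omap f (proj_outer i p o).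
  by case: o => [l|] //=; rewrite H; case: (p l).
have E2 o : proj_inner p' (omap h o) = omap g (proj_inner p o).
  by case: o => [l|] //=; rewrite H; case: (p l).
apply: corolla_eq => [|o].
  by apply/setP => -[[a b] c]; rewrite mem_pull !mem_glue M !mem_pull !E1 !E2.
rewrite col_pull !col_glue M; case: o => [l|] /=; last by rewrite col_pull.
by rewrite H; case: (p l) => ?; rewrite col_pull.
Qed.

Lemma cyclic_order0 : cyclic_order (set0 : {set option unit * option unit * option unit}).
Proof.
apply/cyclic_orderP; split=> [a b c|a b c|a b c d|]; rewrite ?inE //.
by move=> [[]|] [[]|] [[]|].
Qed.

Definition unit_corolla : corolla unit := Sub (set0, [ffun=> false]) cyclic_order0.

Lemma glue_unitl (I : finType) (s : splits tt (@inr unit I)) (x : corolla I) :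
  corolla_iso (glue s unit_corolla x) x.
Proof.
rewrite /corolla_iso; set x' := match_colour tt unit_corolla x.
suff -> : glue s unit_corolla x = x'.
  by rewrite /x' /match_colour; case: ifP; rewrite eqxx ?orbT.
have E o : proj_inner (@inr unit I) o = o by case: o.
apply: corolla_eq => [|h].
  by apply/setP => -[[a b] c]; rewrite mem_glue -/x' !E /cyc /= inE.
rewrite col_glue -/x'; case: h => // .
rewrite /x' /match_colour {1 2}/col /= !ffunE.
by case: eqP => [//|]; rewrite col_reflect; case: (col x None).
Qed.

Lemma glue_unitr (I : finType) (i : I)
   (s : splits i (fun a : I => if a == i then inr tt else inl a)) (x : corolla I) :
  glue s x unit_corolla = x.
Proof.
have E o : proj_outer i (fun a : I => if a == i then inr tt else inl a) o = o.
  by case: o => [a|] //=; case: eqP => // ->.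
have c0 : cyc (match_colour i x unit_corolla) = set0.
  rewrite /match_colour; case: ifP => _ //.
  by apply/setP => -[[a b] c]; rewrite mem_reflect /cyc /= !inE.
apply: corolla_eq => [|h].
  by apply/setP => -[[a b] c]; rewrite mem_glue c0 !E inE orbF.
rewrite col_glue; case: h => // a; case: eqP => // ->.
rewrite /match_colour {2}/col /= ffunE.
by case e: (col x (Some i)); rewrite ?col_reflect /col /= ffunE.
Qed.

Definition moebius_glue (I J L : finType) (i : I) (p : L -> I + J)
    (sp : splits i p) (a : moebius I) (b : moebius J) : moebius L :=
  moebius_class (glue sp (moebius_repr a) (moebius_repr b)).

Definition moebius_pull (I J : finType) (f : I -> J) (fI : injective f)
    (a : moebius J) : moebius I :=
  moebius_class (pull_corolla fI (moebius_repr a)).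

Lemma moebius_glue_class (I J L : finType) (i : I) (p : L -> I + J)
    (sp : splits i p) x y :
  moebius_glue sp (moebius_class x) (moebius_class y) = moebius_class (glue sp x y).
Proof.
rewrite /moebius_glue.
case/orP: (moebius_repr_iso x) => /eqP->; case/orP: (moebius_repr_iso y) => /eqP->;
  by rewrite ?glue_reflectl ?glue_reflectr ?moebius_class_reflect.
Qed.

Lemma moebius_pull_class (I J : finType) (f : I -> J) (fI : injective f) x :
  moebius_pull fI (moebius_class x) = moebius_class (pull_corolla fI x).
Proof.
rewrite /moebius_pull.
by case/orP: (moebius_repr_iso x) => /eqP->; rewrite ?pull_reflect ?moebius_class_reflect.
Qed.

Lemma moebiusW (I : finType) (P : moebius I -> Prop) :
  (forall x, P (moebius_class x)) -> forall a, P a.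
Proof. by move=> H a; rewrite -(moebius_reprK a). Qed.

Section Bilinear.
Variable k : fieldType.

Definition lin2 (A B C : finType) (G : A -> B -> C)
    (x : {ffun A -> k^o}) (y : {ffun B -> k^o}) : {ffun C -> k^o} :=
  [ffun w => \sum_a \sum_b x a * y b * (G a b == w)%:R].

Lemma lin2_sum (A B C : finType) (G : A -> B -> C) x y (h : C -> k) :
  \sum_m lin2 G x y m * h m = \sum_a \sum_b x a * y b * h (G a b).
Proof.
under eq_bigr do rewrite ffunE mulr_suml.
rewrite exchange_big; apply: eq_bigr => a _.
under eq_bigr do rewrite mulr_suml.
rewrite exchange_big; apply: eq_bigr => b _.
rewrite (bigD1 (G a b)) //= eqxx mulr1 big1 ?addr0 // => m.
by rewrite eq_sym => /negbTE->; rewrite mulr0 mul0r.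
Qed.

Lemma lin2_lin2l (A B C D E : finType) (G : A -> B -> D) (G' : D -> C -> E) x y z w :
  lin2 G' (lin2 G x y) z w =
  \sum_a \sum_b \sum_c x a * y b * z c * (G' (G a b) c == w)%:R.
Proof.
rewrite ffunE.
under eq_bigr => m _ do (under eq_bigr do rewrite -mulrA; rewrite -mulr_sumr).
rewrite lin2_sum; do 2!apply: eq_bigr => ? _.
by rewrite mulr_sumr; apply: eq_bigr => c _; rewrite !mulrA.
Qed.

Lemma lin2_lin2r (A B C D E : finType) (G : B -> C -> D) (G' : A -> D -> E) x y z w :
  lin2 G' x (lin2 G y z) w =
  \sum_a \sum_b \sum_c x a * y b * z c * (G' a (G b c) == w)%:R.
Proof.
rewrite ffunE; apply: eq_bigr => a _.
under eq_bigr do rewrite -mulrA [_ * (_ * _)]mulrCA.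
rewrite lin2_sum; do 2!apply: eq_bigr => ? _.
by rewrite mulrCA !mulrA.
Qed.

Lemma lin2_linearr (A B C : finType) (G : A -> B -> C) x : linear (lin2 G x).
Proof.
move=> c y z; apply/ffunP => w; rewrite !ffunE scaler_sumr -big_split /=.
apply: eq_bigr => a _; rewrite scaler_sumr -big_split /=; apply: eq_bigr => b _ /=.
by rewrite !ffunE mulrDr mulrDl; congr (_ + _); rewrite /GRing.scale /= -!mulrA mulrCA.
Qed.

Lemma lin2_linearl (A B C : finType) (G : A -> B -> C) y :
  linear (fun x => lin2 G x y).
Proof.
move=> c x z; apply/ffunP => w; rewrite !ffunE scaler_sumr -big_split /=.
apply: eq_bigr => a _; rewrite scaler_sumr -big_split /=; apply: eq_bigr => b _ /=.
by rewrite !ffunE !mulrDl; congr (_ + _); rewrite /GRing.scale /= -!mulrA.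
Qed.

End Bilinear.

Section MAss.
Variable k : fieldType.

(* The space spanned by the isomorphism classes, as coefficient functions;
   the coefficient at w of a relabelled element is the coefficient of the
   original one at w relabelled backwards. *)
Definition mass_sort (I : finType) : lmodType k := {ffun moebius I -> k^o}.

Definition mass_act (I J : finType) (f : I -> J) (fB : bijective f)
    (x : mass_sort I) : mass_sort J :=
  [ffun w => x (moebius_pull (bij_inj fB) w)].

Definition mass_comp (I J L : finType) (i : I) (p : L -> I + J)
    (sp : splits i p) : mass_sort I -> mass_sort J -> mass_sort L :=
  lin2 (moebius_glue sp).

Definition mass_unit : mass_sort unit :=
  [ffun w => (w == moebius_class unit_corolla)%:R].

Lemma moebius_pull_bij (I J : finType) (f : I -> J) (fB : bijective f) :
  bijective (moebius_pull (bij_inj fB)).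
Proof.
case: (fB) => g fK gK; have gB : bijective g by exists f.
exists (moebius_pull (bij_inj gB)) => a; elim/moebiusW: a => x;
  rewrite !moebius_pull_class; congr moebius_class.
- rewrite (pull_comp (h := id) _ _ (@inj_id _)) ?pull_id // => o; by rewrite /= gK.
- rewrite (pull_comp (h := id) _ _ (@inj_id _)) ?pull_id // => o; by rewrite /= fK.
Qed.

Fact mass_act_linear (I J : finType) (f : I -> J) (fB : bijective f) :
  linear (mass_act fB).
Proof. by move=> c x y; apply/ffunP => w; rewrite !ffunE. Qed.

Fact mass_act_id (I : finType) (f : I -> I) (fB : bijective f) x :
  f =1 id -> mass_act fB x = x.
Proof.
move=> fE; apply/ffunP; elim/moebiusW => w.
by rewrite ffunE moebius_pull_class pull_id.
Qed.

Fact mass_act_comp (I J L : finType)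
    (f : I -> J) (g : J -> L) (h : I -> L)
    (fB : bijective f) (gB : bijective g) (hB : bijective h) x :
  h =1 g \o f -> mass_act gB (mass_act fB x) = mass_act hB x.
Proof.
move=> hE; apply/ffunP; elim/moebiusW => w.
by rewrite !ffunE !moebius_pull_class (pull_comp _ _ (bij_inj hB)).
Qed.

Fact mass_comp_act (I J L I' J' L' : finType) (i : I)
    (p : L -> I + J) (p' : L' -> I' + J')
    (f : I -> I') (g : J -> J') (h : L -> L')
    (fB : bijective f) (gB : bijective g) (hB : bijective h)
    (sp : splits i p) (sp' : splits (f i) p') x y :
  (forall l, p' (h l) = match p l with
                        | inl a => inl (f a)
                        | inr b => inr (g b)
                        end) ->
  mass_comp sp' (mass_act fB x) (mass_act gB y) = mass_act hB (mass_comp sp x y).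
Proof.
move=> H; apply/ffunP => w; rewrite !ffunE.
rewrite [RHS](reindex _ (onW_bij _ (moebius_pull_bij fB))); apply: eq_bigr => a _.
rewrite [RHS](reindex _ (onW_bij _ (moebius_pull_bij gB))); apply: eq_bigr => b _.
rewrite !ffunE; congr (_ * _%:R).
rewrite -(inj_eq (bij_inj (moebius_pull_bij hB))); congr (nat_of_bool (_ == _)).
elim/moebiusW: a => a; elim/moebiusW: b => b.
by rewrite !(moebius_pull_class, moebius_glue_class) (pull_glue sp sp' (bij_inj fB) (bij_inj gB)).
Qed.

Fact mass_comp_seq (I J L M M' N : finType) (i : I) (j : J) (m : M)
    (p : M -> I + J) (q : N -> M + L) (r : M' -> J + L) (s : N -> I + M')
    (sp : splits i p) (sq : splits m q) (sr : splits j r) (ss : splits i s)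
    x y z :
  p m = inr j ->
  (forall n, match q n with
             | inl m => match p m with
                        | inl a => inl a
                        | inr b => inr (inl b)
                        end
             | inr c => inr (inr c)
             end = match s n with
                   | inl a => inl a
                   | inr m' => inr (r m')
                   end) ->
  mass_comp sq (mass_comp sp x y) z = mass_comp ss x (mass_comp sr y z).
Proof.
move=> pm H; apply/ffunP => w; rewrite lin2_lin2l lin2_lin2r.
apply: eq_bigr => a _; apply: eq_bigr => b _; apply: eq_bigr => c _.
elim/moebiusW: a => a; elim/moebiusW: b => b; elim/moebiusW: c => c.
by rewrite !moebius_glue_class (glue_seq_assoc sp sq sr ss).
Qed.

Fact mass_comp_par (I J L M M' N : finType) (i i' : I) (m : M) (m' : M')
    (p : M -> I + J) (q : N -> M + L) (r : M' -> I + L) (s : N -> M' + J)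
    (sp : splits i p) (sq : splits m q) (sr : splits i' r) (ss : splits m' s)
    x y z :
  p m = inl i' -> r m' = inl i ->
  (forall n, match q n with
             | inl m => match p m with
                        | inl a => inl (inl a)
                        | inr b => inr b
                        end
             | inr c => inl (inr c)
             end = match s n with
                   | inl m' => inl (r m')
                   | inr b => inr b
                   end) ->
  mass_comp sq (mass_comp sp x y) z = mass_comp ss (mass_comp sr x z) y.
Proof.
move=> pm rm H; apply/ffunP => w; rewrite !lin2_lin2l.
apply: eq_bigr => a _; rewrite exchange_big.
apply: eq_bigr => c _; apply: eq_bigr => b _.
elim/moebiusW: a => a; elim/moebiusW: b => b; elim/moebiusW: c => c.
by rewrite !moebius_glue_class (glue_par_assoc sp sq sr ss) // -!mulrA [_ * (z _ * _)]mulrCA.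
Qed.

Fact mass_unitl (I : finType) (s : splits tt (@inr unit I)) x :
  mass_comp s mass_unit x = x.
Proof.
apply/ffunP => w; rewrite ffunE (bigD1 (moebius_class unit_corolla)) //=.
rewrite [X in _ + X]big1 ?addr0 => [|a /negbTE an]; last first.
  by apply: big1 => b _; rewrite ffunE an !mul0r.
have E b : moebius_glue s (moebius_class unit_corolla) b = b.
  elim/moebiusW: b => b; rewrite moebius_glue_class.
  exact/moebius_classP/glue_unitl.
under eq_bigr do rewrite ffunE eqxx mul1r E.
rewrite (bigD1 w) //= eqxx mulr1 big1 ?addr0 // => b /negbTE->.
by rewrite mulr0.
Qed.

Fact mass_unitr (I : finType) (i : I)
    (s : splits i (fun a : I => if a == i then inr tt else inl a)) x :
  mass_comp s x mass_unit = x.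
Proof.
apply/ffunP => w; rewrite ffunE exchange_big.
rewrite (bigD1 (moebius_class unit_corolla)) //=.
rewrite [X in _ + X]big1 ?addr0 => [|a /negbTE an]; last first.
  by apply: big1 => b _; rewrite ffunE an mulr0 mul0r.
have E b : moebius_glue s b (moebius_class unit_corolla) = b.
  by elim/moebiusW: b => b; rewrite moebius_glue_class glue_unitr.
under eq_bigr do rewrite ffunE eqxx mulr1 E.
rewrite (bigD1 w) //= eqxx mulr1 big1 ?addr0 // => b /negbTE->.
by rewrite mulr0.
Qed.

Definition MAss : operad k := {|
  op_sort := mass_sort;
  op_act := mass_act;
  op_comp := mass_comp;
  op_unit := mass_unit;
  op_act_linear := mass_act_linear;
  op_act_id := mass_act_id;
  op_act_comp := mass_act_comp;
  op_comp_linearl := fun I J L i p sp y => lin2_linearl (moebius_glue sp) y;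
  op_comp_linearr := fun I J L i p sp x => lin2_linearr (moebius_glue sp) x;
  op_comp_act := mass_comp_act;
  op_comp_seq := mass_comp_seq;
  op_comp_par := mass_comp_par;
  op_unitl := mass_unitl;
  op_unitr := mass_unitr
|}.

End MAss.

(* Main.v *)
Require Import Defs.
From mathcomp Require Import all_boot all_order all_algebra.
From HB Require Import structures.
From mathcomp Require Import all_fingroup zify.
From Stdlib Require Import FunctionalExtensionality.
Set Implicit Arguments.
Unset Strict Implicit.
Unset Printing Implicit Defensive.
Import GRing.Theory.
Import Defs.
Local Open Scope ring_scope.

(** The operad of Moebius trees differs from the associative one only by
colours of the legs, and its dual dg operad is a direct sum of cellular
complexes of associahedra.

Let T be a reduced tree, and P(T) the tensor product over K of the spaces
spanned by the corollas at its vertices.  After reflecting some of the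
vertices, the two halves of each inner edge have the same colour in any given
monomial of P(T); its corollas are then oriented consistently and merge into
one order s of the leaves, for which each vertex of T is an interval
([consistent_repr], [consistent_planar], [planar_corolla_surj]).  Moving the
generator of K across an inner edge flips the colours of both halves, which
therefore do not matter, and a K-linear function on P(T) amounts to
arbitrary scalars attached to the pairs (s, L), with s an order adapted to T
and L the set of the leaves of colour 1, the output being of colour 0
([dual_planar], [dual_of_in_dual], [dual_of_planar]).  The merged order and
the colours of the legs do not change when an edge is contracted
([contract_planar]).  Hence the complex splits: for each pair (s, L) it is the
complex of the functions of T, where T runs over the trees all of whose
vertices are intervals for s, with the differential that adds an edge
([dC_planar]).

The inner edges of such trees form a simplicial complex, of which each piece
is the augmented cochain complex: its simplices are the families of pairwise
nested or disjoint proper intervals with at least two elements, that is, the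
bracketings of n letters.  It is the boundary of the polytope dual to the
associahedron, and what is needed is that its reduced cohomology is
concentrated in top degree ([bracketing_exact]).  This follows from element
matchings: if adding or removing one fixed interval pairs off the simplices of
a subquotient, then that part is acyclic ([exact_on_toggle]).  With positions
counted from 0, the intervals [0, 1], [0, 2], ..., [0, n - 2], then [1, 2],
..., [1, n - 2], and so on, used in this order, leave a single simplex, the
right comb whose n - 2 edges are the intervals ending at n - 1, and this
simplex has top dimension ([card_comb]). *)

(** * Cochains of a simplicial complex *)

Section Simplicial.
Variables (A : finType) (k : fieldType).
Implicit Types (X Y : {set A}) (e f v : A) (F : {set A} -> k).

Definition sgn X e : k := (-1) ^+ index e (enum X).

Definition coboundary F X : k := \sum_(e in X) sgn X e * F (X :\ e).

(** The sign of e in X counts the elements of X before e in a fixed order of the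
whole vertex set, which makes it comparable for different X. *)
Definition before (y e : A) : bool := (index y (enum A) < index e (enum A))%N.

Lemma index_filter (s : seq A) (a : pred A) e : uniq s -> e \in s -> a e ->
  index e (filter a s) = count (fun y => a y && (index y s < index e s)%N) s.
Proof.
elim: s => //= x s IH /andP[xs us]; rewrite inE; have [->|xe] /= := eqVneq e x.
  move=> _ ax; rewrite ax /= !eqxx /=.
  by rewrite (@eq_count _ _ pred0) ?count_pred0 // => y; rewrite ltn0 andbF.
rewrite eqxx => es ae.
have E : count (fun y => a y && ((if x == y then 0 else (index y s).+1) < (index e s).+1)%N) s
  = count (fun y => a y && (index y s < index e s)%N) s.
  apply: eq_in_count => y ys; case: eqP => [xy|//].
  by rewrite xy ys in xs.
by rewrite E -IH //; case: ifP => ax //=; rewrite eq_sym (negbTE xe).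
Qed.

Lemma index_enum X e : e \in X ->
  index e (enum X) = (\sum_(y in X) before y e)%N.
Proof.
move=> eX; rewrite {1}/enum_mem -enumT index_filter ?enum_uniq ?mem_enum //.
rewrite -sum1_count big_mkcond big_enum [RHS]big_mkcond /=.
by apply: eq_bigr => y _; rewrite /before; case: (y \in X) => //=; case: ifP.
Qed.

Lemma before_total e f : e != f -> before f e = ~~ before e f.
Proof.
move=> ef; rewrite /before -leqNgt [RHS]leq_eqVlt.
case: eqP => //= ii; case/eqP: ef.
by apply: index_inj (esym ii); rewrite ?mem_enum.
Qed.

Lemma sgnU X v e : v \notin X -> e \in X -> sgn (v |: X) e = (-1) ^+ before v e * sgn X e.
Proof.
move=> vX eX; rewrite /sgn !index_enum ?inE ?eX ?orbT // big_setU1 //= exprD.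
by [].
Qed.

Lemma sgnD X v e : v \in X -> e \in X -> e != v ->
  sgn X e = (-1) ^+ before v e * sgn (X :\ v) e.
Proof. by move=> vX eX ev; rewrite -{1}(setD1K vX) sgnU ?inE ?eqxx ?ev. Qed.

Lemma sgn_sqr X e : sgn X e * sgn X e = 1.
Proof. by rewrite -expr2 sqrr_sign. Qed.

Lemma sgn_swap X e f : e \in X -> f \in X -> e != f ->
  sgn X e * sgn (X :\ e) f = - (sgn X f * sgn (X :\ f) e).
Proof.
move=> eX fX ef; rewrite (sgnD fX eX ef) (sgnD eX fX) 1?eq_sym //.
by rewrite (before_total ef); case: (before e f);
    rewrite ?expr0 ?expr1 !(mul1r, mulN1r, mulNr) ?opprK mulrC.
Qed.

Lemma coboundaryK F X : coboundary (coboundary F) X = 0.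
Proof.
rewrite /coboundary.
pose g e f := sgn X e * sgn (X :\ e) f * F (X :\ e :\ f).
transitivity (\sum_(e in X) \sum_(f in X | f != e) g e f).
  apply: eq_bigr => e eX; rewrite mulr_sumr; apply: eq_big => [f|f _].
    by rewrite !inE andbC.
  by rewrite mulrA.
transitivity (\sum_(e in X) \sum_(f in X | before e f) g e f +
              \sum_(e in X) \sum_(f in X | before f e) g e f).
  rewrite -big_split; apply: eq_bigr => e eX.
  rewrite (bigID (before e)) /=; congr (_ + _); apply: eq_bigl => f; rewrite -andbA; congr andb.
    by rewrite andbC; case b: (before e f) => //=; apply: contraTneq b => ->; rewrite /before ltnn.
  have [->|fe] := eqVneq f e; first by rewrite /before ltnn.
  by rewrite (before_total fe) negbK.
have -> : \sum_(e in X) \sum_(f in X | before f e) g e f =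
          \sum_(e in X) \sum_(f in X | before e f) g f e.
  rewrite (exchange_big_dep (mem X)) /=; last by move=> ? ? ? /andP[].
  by apply: eq_bigr => e eX; apply: eq_bigl => f; rewrite eX.
rewrite -big_split big1 //= => e eX.
rewrite -big_split big1 //= => f /andP[fX bf].
have ef : e != f by apply: contraTneq bf => ->; rewrite /before ltnn.
by rewrite /g (sgn_swap eX fX ef) mulNr [X :\ f :\ e]setDDl setUC -setDDl addNr.
Qed.



Section Toggle.
Variables (D R : pred {set A}) (v : A) (F : {set A} -> k).
Hypotheses (Rup : forall X Y, R X -> X \subset Y -> D Y -> R Y)
  (Rv : forall X, R X -> v \in X -> R (X :\ v))
  (FR : forall X, ~~ R X -> F X = 0) (FZ : forall X, D X -> coboundary F X = 0).

Definition toggle_homotopy X : k :=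
  if R X && (v \notin X) then sgn (v |: X) v * F (v |: X) else 0.

(** Adding v is a contracting homotopy on the part of R where v can be added.
That the families of R cannot be left by removing v, nor entered from outside
by removing any vertex, makes the unwanted terms vanish. *)
Lemma coboundary_toggle X : D X -> ~~ R X || D (v |: X) -> coboundary toggle_homotopy X = F X.
Proof.
move=> DX; have [RX|RX _] := boolP (R X); last first.
  rewrite FR // /coboundary big1 // => e eX; rewrite /toggle_homotopy;
      case: ifP => [/andP[RXe _]|]; last by rewrite mulr0.
  by rewrite (Rup RXe) ?subsetDl in RX.
rewrite /= => DvX; have [vX|vX] := boolP (v \in X).
  rewrite /coboundary (bigD1 v) //= big1 ?addr0 => [|e /andP[eX ev]]; last first.
    by rewrite /toggle_homotopy !inE vX eq_sym ev andbF mulr0.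
  by rewrite /toggle_homotopy Rv // !inE eqxx setD1K // mulrA sgn_sqr mul1r.
have := FZ DvX; rewrite /coboundary big_setU1 //= setU1K // => /(canRL (addKr _));
    rewrite addr0 => E.
have {}E : F X = - (sgn (v |: X) v * \sum_(i in X) sgn (v |: X) i * F ((v |: X) :\ i)).
  by rewrite E -mulrN opprK mulrA sgn_sqr mul1r.
rewrite E mulr_sumr -sumrN; apply: eq_bigr => e eX.
have ev : e != v by apply: contraNneq vX => <-.
have -> : (v |: X) :\ e = v |: (X :\ e).
  by apply/setP => y; rewrite !inE; have [->|] := eqVneq y v; rewrite //= ?orbT // eq_sym ev.
rewrite /toggle_homotopy !inE (negbTE vX) andbF andbT; case: ifP => [RXe|/negbT RXe]; last first.
  suff -> : F (v |: X :\ e) = 0 by rewrite !mulr0 oppr0.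
  apply: FR; apply: contra RXe => RvXe.
  have /Rv : R (v |: X :\ e) by [].
  by rewrite setU11 setU1K ?inE ?(negbTE vX) ?andbF //; apply.
rewrite !mulrA -mulNr; congr (_ * _).
rewrite (sgnU vX eX) (@sgnD (v |: X) e v) ?setU11 ?inE ?eX ?orbT // 1?eq_sym //.
have -> : (v |: X) :\ e = v |: (X :\ e).
  by apply/setP => y; rewrite !inE; have [->|] := eqVneq y v; rewrite //= ?orbT // eq_sym ev.
rewrite (before_total ev); case: (before e v);
    rewrite ?expr0 ?expr1 !(mul1r, mulN1r, mulNr) ?opprK ?mulrN ?opprK mulrC //.
Qed.
End Toggle.

(** Exactness in degree m of the cochains on D, tested only on the cocycles with
support in R. *)
Definition exact_on (D R : pred {set A}) (m : int) : Prop :=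
  forall F, (forall X, F X != 0 -> R X /\ #|X|%:Z = m) ->
    (forall X, D X -> coboundary F X = 0) ->
  exists G, (forall X, G X != 0 -> D X /\ #|X|%:Z = m - 1) /\
    forall X, D X -> coboundary G X = F X.

Lemma exact_onW (D R R' : pred {set A}) m :
  (forall X, R X -> R' X) -> exact_on D R' m -> exact_on D R m.
Proof. by move=> RR ex F FR; apply: ex => X /FR[/RR]. Qed.

(** One step of element matching: a cocycle supported on R is cohomologous to one
supported on the part of R where v cannot be added. *)
Lemma exact_on_toggle (D R : pred {set A}) v m :
  (forall X Y, X \subset Y -> D Y -> D X) ->
  (forall X, R X -> D X) ->
  (forall X Y, R X -> X \subset Y -> D Y -> R Y) ->
  (forall X, R X -> v \in X -> R (X :\ v)) ->
  exact_on D [pred X | R X && ~~ D (v |: X)] m -> exact_on D R m.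
Proof.
move=> Dd RD Rup Rv ex F FR FZ.
have F0 X : ~~ R X -> F X = 0 by move=> RX; apply: contraNeq RX => /FR[].
pose H := toggle_homotopy R v F; have HE := coboundary_toggle Rup Rv F0 FZ.
have Hdeg X : H X != 0 -> [/\ R X, v \notin X & #|v |: X|%:Z = m].
  rewrite /H /toggle_homotopy; case: ifP => [/andP[RX vX]|]; last by rewrite eqxx.
  by rewrite mulf_eq0 negb_or => /andP[_ /FR[_]].
pose F' X := if D X then F X - coboundary H X else 0.
have [X|X DX|G [GD GE]] := ex F'.
- rewrite /F'; case: ifP => [DX|]; last by rewrite eqxx.
  move=> n0; split.
    by apply: contraNT n0; rewrite negb_and negbK => h; rewrite HE ?subrr.
  have [/FR[]//|] := boolP (F X != 0); rewrite negbK => /eqP FX0.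
  have /eqP : coboundary H X != 0 by apply: contraNneq n0 => ->; rewrite FX0 subrr.
  have [[e /andP[eX /Hdeg[_ vX <-]]] _|no []] :=
    altP (@existsP _ (fun e => (e \in X) && (H (X :\ e) != 0))).
    by rewrite cardsU1 vX (cardsD1 e X) eX.
  rewrite /coboundary big1 // => e eX; apply/eqP; rewrite mulf_eq0 orbC.
  by apply/orP; left; apply: contraR no => h; apply/existsP; exists e; rewrite eX.
- rewrite -[RHS](subrr 0) -{1}(FZ X DX) -(coboundaryK H X) /coboundary -sumrB;
    apply: eq_bigr => e eX.
  by rewrite -mulrBr /F' (Dd _ _ (subsetDl _ _) DX).
exists (fun X => G X + H X); split=> [X|X DX].
  have [->|/GD//] := eqVneq (G X) 0; rewrite add0r => /Hdeg[/RD DX vX].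
  by rewrite cardsU1 vX => <-; split=> //; lia.
have -> : coboundary (fun X => G X + H X) X = coboundary G X + coboundary H X.
  by rewrite /coboundary -big_split; apply: eq_bigr => e _; rewrite mulrDr.
by rewrite GE // /F' DX subrK.
Qed.
End Simplicial.

(** * Families of intervals *)

Section Intervals.
Variables (n : nat) (s : {perm 'I_n}).
Implicit Types (D E : {set 'I_n}) (X Y : {set {set 'I_n}}).

Definition convex D : bool :=
  [forall a in D, forall b in D, forall c, (c \notin D) ==> ((s c < s a)%N == (s c < s b)%N)].

Definition laminar D E : bool := [|| D \subset E, E \subset D | [disjoint D & E]].

Definition interval (i j : nat) : {set 'I_n} := [set l : 'I_n | i <= s l <= j]%N.

Lemma convexP D : reflect (forall a b c, a \in D -> b \in D -> c \notin D ->
  (s c < s a)%N = (s c < s b)%N) (convex D).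
Proof.
apply: (iffP idP) => [/forall_inP h a b c aD bD cD|h].
  by have /forall_inP/(_ _ bD)/forallP/(_ c)/implyP/(_ cD)/eqP := h _ aD.
by apply/forall_inP => a aD; apply/forall_inP => b bD; apply/forallP => c; apply/implyP => cD;
    rewrite (h a b c).
Qed.

Lemma leaf_at i : (i < n)%N -> exists l : 'I_n, s l = i :> nat.
Proof. by move=> lt; exists ((s^-1)%g (Ordinal lt)); rewrite permKV. Qed.

Lemma convex_interval i j : convex (interval i j).
Proof. by apply/convexP => a b c; rewrite !inE; lia. Qed.

(** The end points are the extreme positions of the elements of D. *)
Lemma convexE D : convex D -> D != set0 -> exists p q : nat, [/\ p <= q, q < n & D =
    interval p q]%N.
Proof.
move=> /convexP cD /set0Pn[a0 a0D].
case: (arg_minnP (fun l => s l : nat) a0D) => a aD amin.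
case: (arg_maxnP (fun l => s l : nat) a0D) => b bD bmax.
exists (s a), (s b); split; rewrite ?ltn_ord ?amin //.
apply/setP => c; rewrite inE; apply/idP/idP => [cD'|/andP[ac cb]]; first by rewrite amin //=;
    exact: bmax.
apply: contraTT cb => cD'; rewrite -ltnNge.
have := cD a b c aD bD cD'.
have : s c != s a :> nat.
  by rewrite (inj_eq val_inj) (inj_eq perm_inj); apply: contraNneq cD' => ->.
have : s c != s b :> nat.
  by rewrite (inj_eq val_inj) (inj_eq perm_inj); apply: contraNneq cD' => ->.
lia.
Qed.

Lemma subset_interval p q i j : (p <= q)%N -> (q < n)%N ->
  (interval p q \subset interval i j) = (i <= p)%N && (q <= j)%N.
Proof.
move=> pq qn; apply/subsetP/idP => [h|h l]; last by rewrite !inE; lia.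
have [a aE] := leaf_at (leq_ltn_trans pq qn); have [b bE] := leaf_at qn.
by have := h a; have := h b; rewrite !inE aE bE; lia.
Qed.

Lemma disjoint_interval p q i j : (p <= q)%N -> (q < n)%N -> (i <= j)%N -> (j < n)%N ->
  [disjoint interval p q & interval i j] = (q < i)%N || (j < p)%N.
Proof.
move=> pq qn ij jn; apply/pred0P/idP => [h|h l /=]; last by rewrite !inE; lia.
have mn : (maxn p i < n)%N by lia.
by have [a aE] := leaf_at mn; have := h a; rewrite /= !inE aE; lia.
Qed.

Lemma laminar_interval p q i j : (p <= q)%N -> (q < n)%N -> (i <= j)%N -> (j < n)%N ->
  laminar (interval p q) (interval i j) =
  ~~ ((p < i <= q) && (q < j) || (i < p <= j) && (j < q))%N.
Proof. by move=> pq qn ij jn; rewrite /laminar !subset_interval // disjoint_interval //; lia. Qed.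

Lemma interval_eq p q i j : (p <= q)%N -> (q < n)%N -> (i <= j)%N -> (j < n)%N ->
  (interval p q == interval i j) = (p == i) && (q == j).
Proof. by move=> pq qn ij jn; rewrite eqEsubset !subset_interval //; lia. Qed.

Lemma card_interval_gt1 p q : (p < q)%N -> (q < n)%N -> (1 < #|interval p q|)%N.
Proof.
move=> pq qn.
have [a aE] := leaf_at (ltn_trans pq qn); have [b bE] := leaf_at qn.
apply/card_gt1P; exists a, b; rewrite !inE aE bE; split; try lia.
by apply: contraTneq pq => ab; rewrite -aE -bE ab ltnn.
Qed.

(** The sets of inner edges of the planar trees with leaves in the order s. *)
Definition bracketing X : bool :=
  [forall D in X, [&& D != setT, (1 < #|D|)%N & convex D]] &&
  [forall D in X, forall E in X, laminar D E].

Lemma bracketingP X : reflect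
  ((forall D, D \in X -> [/\ D != setT, (1 < #|D|)%N & convex D]) /\
   (forall D E, D \in X -> E \in X -> laminar D E)) (bracketing X).
Proof.
apply: (iffP andP) => -[h1 h2]; split.
- by move=> D /(forall_inP h1)/and3P.
- by move=> D E /(forall_inP h2)/forall_inP h /h.
- by apply/forall_inP => D /h1 h; apply/and3P.
- by apply/forall_inP => D DX; apply/forall_inP => E EX; exact: h2.
Qed.

Lemma bracketing_sub X Y : X \subset Y -> bracketing Y -> bracketing X.
Proof.
move/subsetP=> XY /bracketingP[h1 h2]; apply/bracketingP.
by split=> [D /XY/h1|D E /XY DY /XY]; last exact: h2.
Qed.

Lemma bracketE X D : bracketing X -> D \in X ->
  exists p q : nat, [/\ p < q, q < n & D = interval p q]%N.
Proof.
case/bracketingP=> h _ /h[_ D1 cD].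
have D0 : D != set0 by rewrite -card_gt0 ltnW.
have [p [q [pq qn E]]] := convexE cD D0; exists p, q; split=> //.
rewrite ltn_neqAle pq andbT; apply: contraTneq D1 => pqE; rewrite -leqNgt.
apply/card_le1P => a; rewrite E !inE => ha b; rewrite !inE.
apply/idP/eqP => [hb|->]; last lia.
by apply: (@perm_inj _ s); apply: val_inj => /=; lia.
Qed.

(** The families left after toggling in turn the intervals [j, c] with j < i, and
those with j = i and c < b: they contain the right comb up to i. *)
Definition comb_upto (i b : nat) : pred {set {set 'I_n}} := fun X =>
  [&& bracketing X, [forall j : 'I_n, (0 < j <= i)%N ==> (interval j n.-1 \in X)]
    & (b == i.+1) || [exists c : 'I_n, (b <= c)%N && (interval i.+1 c \in X)]].

Lemma comb_uptoP i b X : (i < n)%N -> reflect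
  [/\ bracketing X, forall j, (0 < j <= i)%N -> interval j n.-1 \in X
    & b = i.+1 \/ exists c, [/\ (b <= c)%N, (c < n)%N & interval i.+1 c \in X]]
  (comb_upto i b X).
Proof.
move=> lt; apply: (iffP and3P) => -[h1 h2 h3]; split=> //.
- move=> j ji; have jn : (j < n)%N by lia.
  by move/forallP/(_ (Ordinal jn))/implyP: h2; apply.
- case/orP: h3 => [/eqP|/existsP[c /andP[bc cX]]]; first by left.
  by right; exists c; split.
- by apply/forallP => j; apply/implyP; exact: h2.
- case: h3 => [->|[c [bc cn cX]]]; first by rewrite eqxx.
  by apply/orP; right; apply/existsP; exists (Ordinal cn); rewrite /= bc.
Qed.

Lemma bracketing_setU1 i b X : bracketing X -> (i < b)%N -> (b < n)%N ->
  interval i b != setT -> (forall D, D \in X -> laminar D (interval i b)) ->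
  bracketing (interval i b |: X).
Proof.
move=> brX ib bn iT lam; have [h1 h2] := bracketingP _ brX.
have lamC D E : laminar D E = laminar E D by rewrite /laminar orbCA disjoint_sym.
apply/bracketingP; split=> [D|D E]; rewrite !inE.
  by case/orP=> [/eqP->|/h1//]; rewrite iT card_interval_gt1 ?convex_interval.
case/orP=> [/eqP->|DX] /orP[/eqP->|EX]; last exact: h2.
- by rewrite /laminar subxx.
- by rewrite lamC lam.
- exact: lam.
Qed.

(** Let [p, q] in X cross [i, b].  If p < i, it would cross [i, n - 1] as well, so
i < p <= b < q.  If p = i + 1, it is an interval as required.  If not, then
b > i + 1, and [i + 1, b] is not in X, since [p, q] would cross it; hence X has
an interval [i + 1, c] with c > b. *)
Lemma comb_upto_step i b X : (i < b)%N -> (b.+1 < n)%N ->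
  comb_upto i b X -> ~~ bracketing (interval i b |: X) -> comb_upto i b.+1 X.
Proof.
move=> ib bn; have lt : (i < n)%N by lia.
case/comb_uptoP=> // brX comb low; apply: contraNT => nlow.
have noc c : (b < c)%N -> (c < n)%N -> interval i.+1 c \notin X.
  move=> bc cn; apply: contra nlow => cX; apply/comb_uptoP=> //; split=> //.
  by right; exists c.
have top : interval 0 n.-1 = setT by apply/setP => l; rewrite !inE; have := ltn_ord (s l); lia.
apply: bracketing_setU1 => //; [lia | rewrite -top interval_eq; lia|].
move=> D DX; have [p [q [pq qn DE]]] := bracketE brX DX.
rewrite DE laminar_interval //; try lia.
have lamD j c : interval j c \in X -> (j <= c)%N -> (c < n)%N ->
    ~~ ((p < j <= q) && (q < c) || (j < p <= c) && (c < q))%N.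
  move=> jX jc cn; rewrite -laminar_interval //; try lia.
  by have [_ h] := bracketingP _ brX; rewrite -DE; apply: h.
apply/negP => /orP[] cross.
  have iX : interval i n.-1 \in X by apply: comb; lia.
  by have := lamD _ _ iX; lia.
have [pi|pi] := eqVneq p i.+1.
  by have := noc q; rewrite -pi -DE DX; lia.
case: low => [bi|[c [bc cn cX]]]; first lia.
have [cb|cb] := eqVneq c b; first by have := lamD _ _ cX; lia.
by have := noc c; rewrite cX; lia.
Qed.

Lemma comb_upto_up i b X Y : (i < n)%N ->
  comb_upto i b X -> X \subset Y -> bracketing Y -> comb_upto i b Y.
Proof.
move=> lt /comb_uptoP[]// _ h2 h3 /subsetP XY brY; apply/comb_uptoP=> //; split=> //.
  by move=> j /h2/XY.
by case: h3 => [->|[c [bc cn /XY cY]]]; [left|right; exists c].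
Qed.

Lemma comb_upto_remove i b X : (i < b)%N -> (b.+1 < n)%N ->
  comb_upto i b X -> comb_upto i b (X :\ interval i b).
Proof.
move=> ib bn; have lt : (i < n)%N by lia.
case/comb_uptoP=> // h1 h2 h3; apply/comb_uptoP=> //; split.
- exact: bracketing_sub (subsetDl _ _) h1.
- move=> j ji; rewrite !inE h2 // andbT interval_eq; lia.
- case: h3 => [->|[c [bc cn cX]]]; [by left|right; exists c; split=> //].
  rewrite !inE cX andbT interval_eq; lia.
Qed.

Lemma comb_upto_next i X : (i.+2 < n)%N ->
  comb_upto i n.-1 X -> comb_upto i.+1 i.+2 X.
Proof.
move=> lt /comb_uptoP[]; first lia.
move=> h1 h2 [|[c [nc cn cX]]]; first lia.
apply/comb_uptoP; [lia|split=> //; last by left].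
move=> j ji; have [->|ne] := eqVneq j i.+1; last by apply: h2; lia.
by have <- : c = n.-1 by lia.
Qed.

(** Once every comb edge is present there is room for no other interval: one
ending at q < n - 1 would cross [q, n - 1]. *)
Lemma card_comb X : (1 < n)%N -> comb_upto (n - 2) n.-1 X -> #|X| = (n - 2)%N.
Proof.
move=> n1 /comb_uptoP[]; first lia; move=> brX comb _.
have top : interval 0 n.-1 = setT by apply/setP => l; rewrite !inE; have := ltn_ord (s l); lia.
have -> : X = [set interval j.+1 n.-1 | j : 'I_(n - 2)].
  apply/setP => D; apply/idP/imsetP => [DX|[j _ ->]]; last first.
    by apply: comb; have := ltn_ord j; lia.
  have [p [q [pq qn DE]]] := bracketE brX DX.
  have [h1 h2] := bracketingP _ brX.
  have pq0 : ~~ ((p == 0%N) && (q == n.-1)).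
    by have [+ _ _] := h1 _ DX; rewrite DE -top interval_eq //; lia.
  have qE : q = n.-1.
    apply/eqP; apply: contraT => qN.
    have qX : interval q n.-1 \in X by apply: comb; lia.
    by have := h2 _ _ DX qX; rewrite DE laminar_interval; lia.
  have pn : (p.-1 < n - 2)%N by lia.
  by exists (Ordinal pn) => //=; rewrite DE qE prednK //; lia.
rewrite card_imset ?card_ord // => i j /eqP; rewrite interval_eq; try (have := ltn_ord i;
    have := ltn_ord j; lia).
by move=> ij; apply: val_inj => /=; lia.
Qed.

(** The associahedra have no cohomology below the top degree: the element
matchings exhaust all bracketings but the right comb. *)
Theorem bracketing_exact (k : fieldType) (m : int) : (1 < n)%N ->
  m != n%:Z - 2 -> @exact_on _ k bracketing bracketing m.
Proof.
move=> n1 mn.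
have step i b : (i < b)%N -> (b.+1 < n)%N -> @exact_on _ k bracketing (comb_upto i b.+1) m ->
    @exact_on _ k bracketing (comb_upto i b) m.
  move=> ib bn ex; apply: (@exact_on_toggle _ _ _ _ (interval i b)).
  - exact: bracketing_sub.
  - by move=> X /and3P[].
  - by move=> X Y; apply: comb_upto_up; lia.
  - by move=> X RX _; apply: comb_upto_remove.
  - by apply: exact_onW ex => X /andP[]; exact: comb_upto_step.
have row i : (i.+1 < n)%N -> @exact_on _ k bracketing (comb_upto i n.-1) m ->
    @exact_on _ k bracketing (comb_upto i i.+1) m.
  move=> lt ex; have : (i.+1 <= n.-1)%N by lia.
  move: {-2}(n.-1) (leqnn n.-1) ex => b; elim: b => [|b IH] bn ex ib; first lia.
  have [bi|bi] := eqVneq b i; first by rewrite -{2}bi.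
  by apply: IH; try lia; apply: step => //; lia.
have last_row : @exact_on _ k bracketing (comb_upto (n - 2) n.-1) m.
  move=> F FR _; exists (fun=> 0); split=> [X|X _]; first by rewrite eqxx.
  rewrite /coboundary big1 => [|e _]; last by rewrite mulr0.
  apply/esym/eqP; apply: contraNT mn => /FR[/(card_comb n1) cX <-].
  by rewrite cX; lia.
have rows d i : (i + d + 2 = n)%N -> @exact_on _ k bracketing (comb_upto i i.+1) m.
  elim: d i => [|d IH] i idn; apply: row; try lia.
    by have -> : i = (n - 2)%N by lia.
  apply: exact_onW (IH i.+1 _); last lia.
  by move=> X; apply: comb_upto_next; lia.
apply: exact_onW (rows (n - 2)%N 0%N _) => [X brX|]; last lia.
by apply/comb_uptoP; [lia|split=> //; [move=> j; lia|left]].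
Qed.

End Intervals.

(** * Leaves and vertices of a tree *)

Section TreeCombinatorics.
Variables (n : nat).

Definition tset (T : tree n) : {set {set 'I_n}} := val T.
Definition vset (T : tree n) (v : vertex T) : {set 'I_n} := val v.
Definition iset (T : tree n) (v : vertex T) (D : input v) : {set 'I_n} := val D.

Section OneTree.
Variable T : tree n.
Implicit Types (v u : vertex T) (a b c : 'I_n) (D E : {set 'I_n}).

Lemma tsetP : is_tree (tset T).
Proof. exact: (proj2_sig T). Qed.

Lemma vsetP v : vset v \in tset T.
Proof. exact: (proj2_sig v). Qed.

Lemma isetP v (D : input v) : iset D \in inputs (tset T) (vset v).
Proof. exact: (proj2_sig D). Qed.

Lemma vset_inj : injective (@vset T).
Proof. exact: val_inj. Qed.

Lemma iset_inj v : injective (@iset T v).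
Proof. exact: val_inj. Qed.

Lemma vset_ex E : E \in tset T -> exists v : vertex T, vset v = E.
Proof. by move=> ET; exists (exist _ E ET). Qed.

Lemma iset_ex v E : E \in inputs (tset T) (vset v) -> exists D : input v, iset D = E.
Proof. by move=> EI; exists (exist _ E EI). Qed.

Lemma root_vset : vset (root_vertex T) = setT.
Proof. by []. Qed.

Lemma node_leaf D : D \in nodes (tset T) -> exists a, a \in D.
Proof.
case/is_treeP: tsetP => _ tc _.
rewrite inE => /orP[/tc c|/imsetP[i _ ->]]; last by exists i; rewrite set11.
by apply/set0Pn; rewrite -card_gt0 (ltn_trans _ c).
Qed.

Lemma nodes_laminar D E : D \in nodes (tset T) -> E \in nodes (tset T) ->
  [\/ D \subset E, E \subset D | [disjoint D & E]].
Proof.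
case/is_treeP: tsetP => _ _ tl.
have single (i : 'I_n) (F : {set 'I_n}) : [\/ [set i] \subset F, F \subset [set i] | [disjoint [set i] & F]].
  by rewrite sub1set disjoints1; case: (i \in F); [constructor 1|constructor 3].
rewrite !inE => /orP[DT|/imsetP[i _ ->]] /orP[ET|/imsetP[j _ ->]]; last exact: single.
- exact: tl.
- by case: (single j D) => h; [constructor 2|constructor 1|constructor 3; rewrite disjoint_sym].
- exact: single.
Qed.

Lemma nodes_meet D E a : D \in nodes (tset T) -> E \in nodes (tset T) ->
  a \in D -> a \in E -> D \subset E \/ E \subset D.
Proof.
move=> DN EN aD aE; case: (nodes_laminar DN EN) => [| |/pred0P/(_ a)]; [by left|by right|].
by rewrite /= aD aE.
Qed.

Lemma vset_node v : vset v \in nodes (tset T).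
Proof. by rewrite inE vsetP. Qed.

Lemma iset_node v (D : input v) : iset D \in nodes (tset T).
Proof. by case/inputsP: (isetP D). Qed.

Lemma iset_proper v (D : input v) : iset D \proper vset v.
Proof. by case/inputsP: (isetP D). Qed.

Lemma iset_sub v (D : input v) : iset D \subset vset v.
Proof. exact: proper_sub (iset_proper D). Qed.

Lemma iset_uniq v (D D' : input v) a : a \in iset D -> a \in iset D' -> D = D'.
Proof.
move=> aD aD'; apply: iset_inj; apply/eqP; rewrite eqEsubset.
have main (C C' : input v) : iset C \subset iset C' -> iset C' \subset iset C.
  move=> CC'; have [] := boolP (iset C \proper iset C') => [P|]; last by rewrite properE CC' negbK.
  case/inputsP: (isetP C) => CN _ h.
  have := iset_node C'; rewrite inE => /orP[C'T|/imsetP[i _ C'E]].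
    by case: (h (iset C')) => //; exact: iset_proper.
  have [c cC] := node_leaf CN; rewrite C'E in P CC' *.
  by rewrite sub1set; move: (subsetP CC' _ cC); rewrite inE => /eqP <-.
by case: (nodes_meet (iset_node D) (iset_node D') aD aD') => h; rewrite h main.
Qed.

Lemma input_above v D : D \in nodes (tset T) -> D \proper vset v ->
  exists E : input v, D \subset iset E.
Proof.
move=> DN Dv; pose P (E : {set 'I_n}) := (E \in nodes (tset T)) && (E \proper vset v).
have [|E /maxsetP[/andP[EN Ev] Emax] DE] := @maxset_exists _ P D; first by rewrite /P DN.
have /iset_ex[F FE] : E \in inputs (tset T) (vset v).
  apply/inputsP; split=> // F FT EF Fv.
  have FE : F = E by apply: Emax; rewrite ?proper_sub // /P Fv inE FT.
  by rewrite FE properxx in EF.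
by exists F; rewrite FE.
Qed.

Lemma vset_card v : (1 < #|vset v|)%N.
Proof. by case/is_treeP: tsetP => _ /(_ _ (vsetP v)). Qed.

Lemma input_of v a : a \in vset v -> exists D : input v, a \in iset D.
Proof.
move=> av; have aN : [set a] \in nodes (tset T) by rewrite inE imset_f ?orbT.
have aP : [set a] \proper vset v by rewrite properEcard sub1set av cards1 vset_card.
by have [E] := input_above aN aP; rewrite sub1set; exists E.
Qed.

Lemma node_parent D : D \in nodes (tset T) -> D != setT ->
  exists v (E : input v), iset E = D.
Proof.
move=> DN DT; have [tT _ _] := is_treeP tsetP.
pose P (E : {set 'I_n}) := (E \in tset T) && (D \proper E).
have [|E /minsetP[/andP[ET DE] Emin] _] := @minset_exists _ P setT; first by rewrite /P tT properT.
have [v vE] := vset_ex ET; exists v.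
apply: iset_ex; rewrite vE; apply/inputsP; split=> // F FT DF FE.
have EF : F = E by apply: Emin; rewrite ?proper_sub // /P FT.
by rewrite EF properxx in FE.
Qed.

Lemma parent_uniq v u (D : input v) (E : input u) : iset D = iset E -> v = u.
Proof.
move=> DE; case/inputsP: (isetP D) => DN Dv hv; case/inputsP: (isetP E).
rewrite -DE => _ Du hu; have [a aD] := node_leaf DN.
apply: vset_inj; apply/eqP; apply: contraT => vu.
case: (nodes_meet (vset_node v) (vset_node u) (subsetP (proper_sub Dv) _ aD)
        (subsetP (proper_sub Du) _ aD)) => h.
  by case: (hu (vset v)) => //; [exact: vsetP|rewrite properEneq vu].
by case: (hv (vset u)) => //; [exact: vsetP|rewrite properEneq eq_sym vu].
Qed.

(** The smallest vertex above both leaves. *)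
Lemma meet_vertex a b : a != b ->
  exists v (D D' : input v), [/\ a \in iset D, b \in iset D' & D != D'].
Proof.
move=> ab; have [tT _ _] := is_treeP tsetP.
pose P (E : {set 'I_n}) := [&& E \in tset T, a \in E & b \in E].
have [|E /minsetP[/and3P[ET aE bE] Emin] _] := @minset_exists _ P setT; first by rewrite /P tT !inE.
have [v vE] := vset_ex ET; rewrite -vE in aE bE.
have [D aD] := input_of aE; have [D' bD'] := input_of bE.
exists v, D, D'; split=> //; apply/eqP => DD'; subst D'.
have := iset_node D; rewrite inE => /orP[DT|/imsetP[i _ DE]].
  have DE : iset D = E by apply: Emin; rewrite -?vE ?iset_sub // /P DT aD.
  by have := iset_proper D; rewrite DE vE properxx.
by move: aD bD' ab; rewrite DE !inE => /eqP-> /eqP->; rewrite eqxx.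
Qed.

Lemma singleton_notin_tset a : [set a] \notin tset T.
Proof.
apply/negP => /vset_ex[v vE].
by have := vset_card v; rewrite vE cards1.
Qed.

Lemma iset_neqT v (D : input v) : iset D != setT.
Proof. by apply: contraTneq (iset_proper D) => ->; rewrite properE subsetT andbF. Qed.

End OneTree.

Lemma set1_neqT (a : 'I_n) : (1 < n)%N -> [set a] != [set: 'I_n].
Proof. by move=> n1; apply: contraTneq n1 => /(congr1 (fun A : {set _} => #|A|));
    rewrite cards1 cardsT card_ord => <-. Qed.

End TreeCombinatorics.

(** * Corollas and linear orders *)

Section LinearCorolla.
Variable I : finType.
Implicit Types (x y : corolla I) (a b c : I).

(** Cutting the cyclic order at the output makes it a linear order of the inputs. *)
Definition lin x a b : bool := (None, Some a, Some b) \in cyc x.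

Lemma cyc_rot x (a b c : option I) : ((a, b, c) \in cyc x) = ((b, c, a) \in cyc x).
Proof.
have [h _ _ _] := cyclic_orderP _ (valP x).
by apply/idP/idP => [/h|/h/h].
Qed.

Lemma cyc_irr x (a b : option I) : (a, a, b) \notin cyc x.
Proof. by apply/negP => /(cyclic_irr (valP x))[]; rewrite eqxx. Qed.

Lemma cyc_degenerate x (a b c : option I) : a = b \/ b = c \/ a = c -> (a, b, c) \in cyc x = false.
Proof.
case=> [->|[->|->]]; apply/negbTE; first exact: cyc_irr.
  by rewrite cyc_rot cyc_irr.
by rewrite -cyc_rot cyc_irr.
Qed.

Lemma cyc_rev x (a b c : option I) : a != b -> b != c -> a != c ->
  ((c, b, a) \in cyc x) = ((a, b, c) \notin cyc x).
Proof.
move=> ab bc ac; have [_ h2 _ h4] := cyclic_orderP _ (valP x).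
apply/idP/idP => [/h2//|]; have := h4 _ _ _ ab bc ac.
by rewrite /cyc; case: (_ \in _) => //= ->.
Qed.

Lemma lin_irr x a : lin x a a = false.
Proof. by apply: cyc_degenerate; right; left. Qed.

Lemma lin_trans x a b c : lin x a b -> lin x b c -> lin x a c.
Proof. by have [_ _ h _] := cyclic_orderP _ (valP x); exact: h. Qed.

Lemma lin_total x a b : a != b -> lin x b a = ~~ lin x a b.
Proof.
move=> ab; rewrite /lin -cyc_rev // [in RHS]cyc_rot [in RHS]cyc_rot //.
Qed.

Lemma lin_cyc x a b c : lin x a b -> lin x b c -> (Some a, Some b, Some c) \in cyc x.
Proof.
have [h1 _ h3 _] := cyclic_orderP _ (valP x); rewrite /lin => ab bc.
rewrite cyc_rot cyc_rot cyc_rot cyc_rot.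
exact: h3 (h1 _ _ _ bc) (h1 _ _ _ (h1 _ _ _ ab)).
Qed.

Lemma cyc_lin x a b c : a != b -> b != c -> a != c ->
  ((Some a, Some b, Some c) \in cyc x) =
  if lin x a b then lin x b c || ~~ lin x a c else lin x b c && ~~ lin x a c.
Proof.
move=> ab bc ac; have [ba cb ca] := And3 (lin_total x ab) (lin_total x bc) (lin_total x ac).
have rev : (Some c, Some b, Some a) \in cyc x -> ((Some a, Some b, Some c) \in cyc x) = false.
  by have [_ h _ _] := cyclic_orderP _ (valP x); move/h/negbTE.
case AB: (lin x a b) ba => /= ba; case BC: (lin x b c) cb => /= cb;
    case AC: (lin x a c) ca => /= ca.
- exact: lin_cyc.
- exact: lin_cyc.
- by apply: rev; rewrite -cyc_rot; exact: lin_cyc.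
- by rewrite -cyc_rot; exact: lin_cyc.
- by apply: rev; rewrite cyc_rot; exact: lin_cyc.
- by rewrite cyc_rot; exact: lin_cyc.
- by apply: rev; exact: lin_cyc.
- by apply: rev; exact: lin_cyc.
Qed.

(** Three inputs are in cyclic order when a rotation of them is in linear order. *)
Lemma corolla_lin_eq x y : lin x =2 lin y -> col x =1 col y -> x = y.
Proof.
move=> l h; apply: corolla_eq => //; apply/setP => -[[a b] c].
have [->|ab] := eqVneq a b; first by rewrite !cyc_degenerate //; left.
have [->|bc] := eqVneq b c; first by rewrite !cyc_degenerate //; right; left.
have [->|ac] := eqVneq a c; first by rewrite !cyc_degenerate //; right; right.
have rot z : ((a, b, c) \in cyc z) = ((b, c, a) \in cyc z) by rewrite cyc_rot.
case: a b c ab bc ac rot => [a|] [b|] [c|] //= ab bc ac rot.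
- by rewrite !cyc_lin // !l.
- by rewrite -[LHS]cyc_rot -[RHS]cyc_rot; exact: l.
- by rewrite !rot; exact: l.
- exact: l.
Qed.

Definition mk_corolla (R : {set option I * option I * option I}) (cR : cyclic_order R)
  (q : option I -> bool) : corolla I := Sub (R, [ffun h => q h]) cR.

Lemma cyc_mk R cR q : cyc (@mk_corolla R cR q) = R. Proof. by []. Qed.

Lemma col_mk R cR q : col (@mk_corolla R cR q) =1 q.
Proof. by move=> h; rewrite /col /= ffunE. Qed.

Lemma lin_reflect x a b : lin (reflect_corolla x) a b = lin x b a.
Proof. by rewrite /lin mem_reflect -cyc_rot -cyc_rot cyc_rot cyc_rot -cyc_rot. Qed.

End LinearCorolla.

Section KeyOrder.
Variables (H : finType) (key : H -> nat) (key_inj : injective key).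

(** The cyclic order of a finite set placed on a circle by its keys. *)
Definition key_order : {set H * H * H} :=
  [set t | let: (a, b, c) := (key t.1.1, key t.1.2, key t.2) in
     [|| a < b < c, b < c < a | c < a < b]%N].

Lemma key_order_cyclic : cyclic_order key_order.
Proof.
apply/cyclic_orderP; split=> [a b c|a b c|a b c d|a b c]; rewrite ?inE /=; try lia.
by rewrite -!(inj_eq key_inj); lia.
Qed.

End KeyOrder.

(** * Planar monomials *)

Section Standard.
Variables (n : nat) (T : tree n).
Implicit Types (s : {perm 'I_n}) (v u : vertex T) (D E : {set 'I_n}) (Q : {set {set 'I_n}}).

(** Any leaf of D gives the same comparisons with the other inputs of a vertex when
these are intervals; the shift by one reserves the key 0 for the output. *)
Definition key s D : nat := if [pick l in D] is Some l then (s l).+1 else 0.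

Lemma keyE s D : D != set0 -> exists2 l, l \in D & forall s, key s D = (s l).+1.
Proof.
case/set0Pn=> l0 l0D; rewrite /key; case: pickP => [l lD|/(_ l0)]; last by rewrite l0D.
by exists l.
Qed.

Lemma iset_neq0 v (D : input v) : iset D != set0.
Proof. by apply/set0Pn; exact: node_leaf (iset_node D). Qed.

Definition half_key s v (h : option (input v)) : nat :=
  if h is Some D then key s (iset D) else 0.

Lemma half_key_inj s v : injective (@half_key s v).
Proof.
move=> [D|] [E|] //=; last 2 first.
- by have [l _ ->] := keyE s (iset_neq0 D).
- by have [l _ ->] := keyE s (iset_neq0 E).
have [l lD ->] := keyE s (iset_neq0 D); have [m mE ->] := keyE s (iset_neq0 E).
move=> [/val_inj/perm_inj lm]; rewrite -lm in mE.
by congr Some; exact: iset_uniq lD mE.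
Qed.

(** The corollas of the planar tree T with leaves in the order s, where Q is
the set of the legs and edges of colour 1 (the full set standing for the
output): both halves of an edge have the same colour. *)
Definition planar_corolla s Q v : corolla (input v) :=
  mk_corolla (key_order_cyclic (@half_key_inj s v))
    (fun h => if h is Some D then iset D \in Q else vset v \in Q).

Lemma lin_planar s Q v (D E : input v) : lin (planar_corolla s Q v) D E =
    (key s (iset D) < key s (iset E))%N.
Proof. by rewrite /lin cyc_mk inE /=; have [l _ ->] := keyE s (iset_neq0 D); lia. Qed.

Lemma col_planar s Q v h :
  col (planar_corolla s Q v) h = if h is Some D then iset D \in Q else vset v \in Q.
Proof. exact: col_mk. Qed.

Lemma planar_corolla_ext s s' Q Q' v :
  (forall D E : input v, (key s (iset D) < key s (iset E)) =
      (key s' (iset D) < key s' (iset E)))%N ->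
  (forall D : input v, (iset D \in Q) = (iset D \in Q')) ->
  (vset v \in Q) = (vset v \in Q') ->
  planar_corolla s Q v = planar_corolla s' Q' v.
Proof.
move=> h1 h2 h3; apply: corolla_lin_eq => [D E|[D|]]; first by rewrite !lin_planar.
  by rewrite !col_planar.
by rewrite !col_planar.
Qed.

Definition rev_perm s : {perm 'I_n} := perm (inj_comp rev_ord_inj (@perm_inj _ s)).

Lemma rev_permE s l : rev_perm s l = rev_ord (s l).
Proof. by rewrite permE. Qed.

Lemma planar_corolla_reflect s Q v : reflect_corolla (planar_corolla s Q v) =
    planar_corolla (rev_perm s) (~: Q) v.
Proof.
apply: corolla_lin_eq => [D E|h].
  rewrite lin_reflect !lin_planar.
  have [l _ lE] := keyE s (iset_neq0 D); have [m _ mE] := keyE s (iset_neq0 E).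
  rewrite !lE !mE !rev_permE /=; have := ltn_ord (s l); have := ltn_ord (s m); lia.
by rewrite col_reflect !col_planar; case: h => [D|]; rewrite inE.
Qed.

End Standard.

(** * From decorations to planar trees *)

(** An element is sent to the number of its predecessors. *)
Lemma perm_of_order n (lt : rel 'I_n) :
  irreflexive lt -> transitive lt -> (forall a b, a != b -> lt a b || lt b a) ->
  exists s : {perm 'I_n}, forall a b, lt a b = (s a < s b)%N.
Proof.
move=> lt_irr lt_trans lt_total.
pose pos a := #|[set c | lt c a]|.
have pos_lt a : (pos a < n)%N.
  rewrite -[X in (_ < X)%N](card_ord n) -cardsT; apply: proper_card; rewrite properT.
  by apply: contraFneq (lt_irr a) => /setP/(_ a); rewrite !inE.
have mono a b : lt a b -> (pos a < pos b)%N.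
  move=> ab; apply: proper_card; apply/properP; split.
    by apply/subsetP => c; rewrite !inE => /lt_trans; apply.
  by exists a; rewrite !inE ?ab // lt_irr.
have pos_inj : injective (fun a => Ordinal (pos_lt a)).
  move=> a b [pab]; apply/eqP; apply: contraT => /lt_total /orP[]/mono; rewrite pab ltnn //.
exists (perm pos_inj) => a b; rewrite !permE /=.
apply/idP/idP => [/mono//|]; apply: contraTT => nab; rewrite -leqNgt.
have [->//|/lt_total] := eqVneq a b.
by rewrite (negbTE nab) => /mono/ltnW.
Qed.

Section Monomials.
Variables (n : nat) (T : tree n).
Implicit Types (s : {perm 'I_n}) (v u : vertex T) (D E : {set 'I_n}) (Q : {set {set 'I_n}}).
Implicit Types (a b c : 'I_n).

Definition planar s : bool := [forall D in tset T, convex s D].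

Lemma node_convex s D : planar s -> D \in nodes (tset T) -> convex s D.
Proof.
move=> /forall_inP pl; rewrite inE => /orP[/pl//|/imsetP[l _ ->]].
by apply/convexP => a b c; rewrite !inE => /eqP-> /eqP->.
Qed.

(** Two disjoint intervals compare like any of their elements. *)
Lemma iset_key s v (D E : input v) a b : planar s -> D != E -> a \in iset D -> b \in iset E ->
  (key s (iset D) < key s (iset E))%N = (s a < s b)%N.
Proof.
move=> pl DE aD bE.
have [l lD ->] := keyE s (iset_neq0 D); have [m mE ->] := keyE s (iset_neq0 E).
have N (C C' : input v) c : C != C' -> c \in iset C -> c \notin iset C'.
  by move=> CC' cC; apply: contraNN CC' => cC'; apply/eqP; exact: iset_uniq cC cC'.
have /convexP hD := node_convex pl (iset_node D); have /convexP hE := node_convex pl (iset_node E).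
rewrite ltnS (hE _ _ _ mE bE (N _ _ _ DE lD)).
have bD : b \notin iset D by rewrite (N _ _ _ _ bE) // eq_sym.
have ne c : c \in iset D -> s c != s b :> nat.
  by move=> cD; rewrite (inj_eq val_inj) (inj_eq perm_inj); apply: contraNneq bD => <-.
by have := hD _ _ _ lD aD bD; have := ne _ lD; have := ne _ aD; lia.
Qed.

(** A planar monomial is determined by the isomorphism classes of its corollas:
the colours are recovered from the root upwards, and the relative order of two
leaves from the vertex where they meet. *)
Lemma planar_corolla_inj s s' Q Q' : planar s -> planar s' ->
  Q \subset nodes (tset T) -> Q' \subset nodes (tset T) -> setT \notin Q -> setT \notin Q' ->
  (forall v : vertex T, moebius_class (planar_corolla s Q v) =
      moebius_class (planar_corolla s' Q' v)) ->
  s = s' /\ Q = Q'.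
Proof.
move=> pl pl' QN QN' QT QT' eqv.
have eqstd v : (vset v \in Q) = (vset v \in Q') -> planar_corolla s Q v = planar_corolla s' Q' v.
  move=> vQ; have := eqv v => /moebius_classP/orP[]/eqP // E.
  have := congr1 (fun x : corolla _ => col x None) E; rewrite col_reflect !col_planar vQ.
  by case: (_ \in _).
have all v : (vset v \in Q) = (vset v \in Q').
  move: {2}(#|~: vset v|) (leqnn #|~: vset v|) => d; elim: d v => [|d IH] v.
    by rewrite leqn0 cards_eq0 -subset0 subCset setC0 subTset => /eqP->;
        rewrite (negbTE QT) (negbTE QT').
  move=> vd; have [->|vT] := eqVneq (vset v) setT; first by rewrite (negbTE QT) (negbTE QT').
  have [u [D DE]] := node_parent (vset_node v) vT.
  have : planar_corolla s Q u = planar_corolla s' Q' u.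
    apply: eqstd; apply: IH; rewrite -ltnS; apply: leq_trans vd.
    by apply: proper_card; rewrite properC -DE iset_proper.
  by move/(congr1 (fun x : corolla _ => col x (Some D))); rewrite !col_planar DE.
have {eqstd all} eqstd v : planar_corolla s Q v = planar_corolla s' Q' v by exact: eqstd.
split.
  have lt a b : (s a < s b)%N = (s' a < s' b)%N.
    have [->|ab] := eqVneq a b; first by rewrite !ltnn.
    have [v [D [E [aD bE DE]]]] := meet_vertex T ab.
    by rewrite -(iset_key pl DE aD bE) -(iset_key pl' DE aD bE) -!(lin_planar s Q) -!(lin_planar s' Q') eqstd.
  apply/permP => a; apply: val_inj => /=.
  have pos (t : {perm 'I_n}) : t a = #|[set c | t c < t a]%N| :> nat.
    have -> : [set c | t c < t a]%N = (t^-1)%g @: [set i : 'I_n | i < t a]%N.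
      apply/setP => c; rewrite inE; apply/idP/imsetP => [ca|[i + ->]].
        by exists (t c); rewrite ?inE ?permK.
      by rewrite inE permKV.
    rewrite (card_imset _ (@perm_inj _ _)).
    rewrite -sum1dep_card -(big_ord_widen n (fun=> 1%N)) ?sum1_card ?card_ord //.
    exact: ltnW.
  by rewrite [LHS]pos [RHS]pos; apply: eq_card => c; rewrite !inE lt.
have sub (P P' : {set {set 'I_n}}) : (forall v (D : input v), (iset D \in P) = (iset D \in P')) ->
    P \subset nodes (tset T) -> setT \notin P -> P \subset P'.
  move=> PP' PN PT; apply/subsetP => D DP.
  have DT : D != setT by apply: contraNneq PT => <-.
  by have [v [E EE]] := node_parent (subsetP PN _ DP) DT; rewrite -EE -PP' EE.
have QQ v (D : input v) : (iset D \in Q) = (iset D \in Q').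
  by have := congr1 (fun x : corolla _ => col x (Some D)) (eqstd v); rewrite !col_planar.
apply/eqP; rewrite eqEsubset; apply/andP; split; first exact: sub.
by apply: sub => // v D; rewrite QQ.
Qed.

(** Reflecting each vertex by the parity of the colour changes met on the way up
from the root makes the colours of the two halves of every edge agree. *)
Lemma consistent_repr (m : forall v : vertex T, moebius (input v)) :
  exists c : forall v : vertex T, corolla (input v),
  [/\ forall v, m v = moebius_class (c v),
      col (c (root_vertex T)) None = false
    & forall u v (D : input v), iset D = vset u -> col (c v) (Some D) = col (c u) None].
Proof.
pose c0 v := if col (moebius_repr (m v)) None then reflect_corolla (moebius_repr (m v))
             else moebius_repr (m v).
have c0m v : m v = moebius_class (c0 v).
  by rewrite /c0; case: ifP => _; rewrite ?moebius_class_reflect moebius_reprK.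
have c0N v : col (c0 v) None = false.
  by rewrite /c0; case: ifP => h; rewrite ?col_reflect ?h.
pose bit v u := [exists D : input v, (vset u \subset iset D) && col (c0 v) (Some D)].
pose r u := \big[addb/false]_(v | vset u \proper vset v) bit v u.
pose c v := if r v then reflect_corolla (c0 v) else c0 v.
have colc v h : col (c v) h = r v (+) col (c0 v) h.
  by rewrite /c; case: ifP => // _; rewrite col_reflect addTb.
exists c; split=> [v||u v D Du].
- by rewrite c0m /c; case: ifP; rewrite ?moebius_class_reflect.
- rewrite colc c0N addbF /r big_pred0 // => v; rewrite root_vset.
  by rewrite properE subsetT andbF.
have uv : vset u \proper vset v by rewrite -Du iset_proper.
rewrite !colc c0N addbF /r (bigD1 v uv) /= addbC; congr addb.
  have [l lD] := node_leaf (iset_node D).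
  apply/idP/existsP => [h|[E /andP[uE]]]; first by exists D; rewrite -Du subxx.
  by rewrite (iset_uniq lD (subsetP uE l _)) // -Du.
apply: eq_big => [w|w vw].
  apply/idP/andP => [vw|[uw wv]].
    split; first exact: proper_trans vw.
    by apply: contraTneq vw => ->; rewrite properxx.
  have [l lD] := node_leaf (iset_node D); have lu : l \in vset u by rewrite -Du.
  have lv := subsetP (proper_sub uv) _ lu; have lw := subsetP (proper_sub uw) _ lu.
  have vNw : vset v != vset w by apply: contraNneq wv => /vset_inj->.
  case: (nodes_meet (vset_node v) (vset_node w) lv lw) => h; first by rewrite properEneq vNw.
  case/inputsP: (isetP D) => _ _ hD; case: (hD (vset w)); rewrite ?vsetP ?Du //.
  by rewrite properEneq eq_sym vNw.
apply/existsP/existsP => -[E /andP[vE cE]]; exists E; rewrite cE andbT.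
  exact: subset_trans (proper_sub uv) vE.
have [l lD] := node_leaf (iset_node D); have lu : l \in vset u by rewrite -Du.
have [F vF] := input_above (vset_node v) vw.
rewrite (iset_uniq (subsetP vE _ lu) (subsetP vF l _)) //.
exact: subsetP (proper_sub uv) _ lu.
Qed.

Definition child v a : option (input v) := [pick D : input v | a \in iset D].

Lemma childE v (D : input v) a : a \in iset D -> child v a = Some D.
Proof.
rewrite /child; case: pickP => [E aE aD|/(_ D)->//].
by rewrite (iset_uniq aD aE).
Qed.

Lemma child_above u v a b : vset v \proper vset u -> a \in vset v -> b \in vset v ->
  child u a = child u b.
Proof.
move=> vu av bv; have [F vF] := input_above (vset_node v) vu.
by rewrite !(childE (D := F)) // (subsetP vF).
Qed.

(** Every planar structure comes from an order of the leaves, which compares two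
leaves at the vertex where they meet. *)
Lemma consistent_planar (c : forall v : vertex T, corolla (input v)) :
  exists s, planar s /\ forall v (D E : input v), lin (c v) D E =
      (key s (iset D) < key s (iset E))%N.
Proof.
pose ltv v a b := (None, child v a, child v b) \in cyc (c v).
have ltvE v a b : ltv v a b ->
    exists (D E : input v), [/\ a \in iset D, b \in iset E & lin (c v) D E].
  rewrite /ltv /child; case: pickP => [D aD|_]; last by rewrite cyc_degenerate //; left.
  case: pickP => [E bE|_]; last by rewrite cyc_degenerate //; right; right.
  by exists D, E.
have ltvI v (D E : input v) a b : a \in iset D -> b \in iset E -> ltv v a b = lin (c v) D E.
  by move=> aD bE; rewrite /ltv !(childE aD, childE bE).
have ltv_in v a b : ltv v a b -> a \in vset v /\ b \in vset v.
  by move=> /ltvE[D [E [aD bE _]]]; split;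
      [exact: subsetP (iset_sub D) _ aD|exact: subsetP (iset_sub E) _ bE].
have ltv_irr v a : ltv v a a = false by rewrite /ltv cyc_degenerate //; right; left.
have ltv_above u v a b d : vset v \proper vset u -> a \in vset v -> b \in vset v ->
    (ltv u a d = ltv u b d) * (ltv u d a = ltv u d b).
  by move=> vu av bv; rewrite /ltv (child_above vu av bv).
have cmp u v a : a \in vset u -> a \in vset v ->
    [\/ u = v, vset u \proper vset v | vset v \proper vset u].
  move=> au av; have [->|uv] := eqVneq u v; first by constructor 1.
  have vN : vset u != vset v by apply: contraNneq uv => /vset_inj->.
  case: (nodes_meet (vset_node u) (vset_node v) au av) => h; [constructor 2|constructor 3].
    by rewrite properEneq vN.
  by rewrite properEneq eq_sym vN.
pose lt : rel 'I_n := fun a b => [exists v, ltv v a b].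
have [|b a d|a b ab|s sE] := @perm_of_order n lt.
- by move=> a; apply/existsP => -[v]; rewrite ltv_irr.
- move=> /existsP[v h] /existsP[w h']; apply/existsP.
  have [_ bv] := ltv_in _ _ _ h; have [bw _] := ltv_in _ _ _ h'.
  have [av _] := ltv_in _ _ _ h; have [_ dw] := ltv_in _ _ _ h'.
  case: (cmp v w b bv bw) => [vw|vw|vw].
  + subst w; exists v; have [D [E [aD bE DE]]] := ltvE _ _ _ h.
    have [E' [F [bE' dF]]] := ltvE _ _ _ h'; rewrite -(iset_uniq bE bE') => EF.
    by rewrite (ltvI _ _ _ _ _ aD dF); apply: lin_trans EF.
  + by exists w; rewrite (ltv_above _ _ _ _ _ vw av bv).
  + by exists v; rewrite (ltv_above _ _ _ _ _ vw dw bw).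
- have [v [D [E [aD bE DE]]]] := meet_vertex T ab.
  have [h|h] := boolP (lin (c v) D E).
    by apply/orP; left; apply/existsP; exists v; rewrite (ltvI _ _ _ _ _ aD bE).
  by apply/orP; right; apply/existsP; exists v; rewrite (ltvI _ _ _ _ _ bE aD) lin_total.
(* A leaf outside v is compared with those of v at a vertex above v, where the
latter are all in the same input. *)
have pl : planar s.
  apply/forall_inP => _ /vset_ex[v <-]; apply/convexP => a b d av bv dv; rewrite -!sE.
  have side u e : e \in vset v -> ltv u d e || ltv u e d -> vset v \proper vset u.
    move=> ev h; have [eu du] : e \in vset u /\ d \in vset u.
      by case/orP: h => /ltv_in[].
    by case: (cmp v u e ev eu) => // [vu|/proper_sub/subsetP/(_ _ du)];
        [rewrite vu du in dv|rewrite (negbTE dv)].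
  apply/existsP/existsP => -[u h]; exists u.
    by rewrite -(ltv_above u v a b d (side u a av _) av bv).2 // h.
  by rewrite (ltv_above u v a b d (side u b bv _) av bv).2 // h.
exists s; split=> // v D E.
have [->|DE] := eqVneq D E; first by rewrite lin_irr ltnn.
have [a aD] := node_leaf (iset_node D); have [b bE] := node_leaf (iset_node E).
rewrite (iset_key pl DE aD bE) -sE; apply/idP/existsP => [h|[u h]].
  by exists v; rewrite (ltvI _ _ _ _ _ aD bE).
have av := subsetP (iset_sub D) _ aD; have bv := subsetP (iset_sub E) _ bE.
have [au bu] := ltv_in _ _ _ h.
case: (cmp u v a au av) => [uv|uv|vu].
- by subst u; rewrite -(ltvI _ _ _ _ _ aD bE).
- by case/eqP: DE; have := child_above uv au bu; rewrite (childE aD) (childE bE) => -[].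
- by rewrite (ltv_above _ _ _ b _ vu) // ltv_irr in h.
Qed.

(** With consistent orientations, the colours of the legs and edges and the order
of the leaves can be read off. *)
Lemma planar_corolla_surj (m : forall v : vertex T, moebius (input v)) :
  exists s Q, [/\ planar s, Q \subset nodes (tset T), setT \notin Q
    & forall v, m v = moebius_class (planar_corolla s Q v)].
Proof.
have [c [cm cr cc]] := consistent_repr m.
have [s [pl ls]] := consistent_planar c.
pose Q := [set D | [exists v, exists E : input v, (iset E == D) && col (c v) (Some E)]].
have QE v (E : input v) : (iset E \in Q) = col (c v) (Some E).
  rewrite inE; apply/existsP/idP => [[u /existsP[F /andP[/eqP FE]]]|h]; last first.
    by exists v; apply/existsP; exists E; rewrite eqxx.
  have uv := parent_uniq FE; subst u.
  by rewrite (iset_inj FE).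
exists s, Q; split=> //.
- by apply/subsetP => D; rewrite inE => /existsP[v /existsP[E /andP[/eqP<- _]]]; exact: iset_node.
- by rewrite inE; apply/existsP => -[v /existsP[E]]; rewrite (negbTE (iset_neqT E)).
move=> v; rewrite cm; congr moebius_class; apply: corolla_lin_eq => [D E|[D|]].
- by rewrite lin_planar ls.
- by rewrite col_planar QE.
rewrite col_planar; have [vT|vT] := eqVneq (vset v) setT.
  have -> : v = root_vertex T by apply: vset_inj; rewrite vT root_vset.
  rewrite cr root_vset; apply/esym/negbTE.
  by rewrite inE; apply/existsP => -[u /existsP[E]]; rewrite (negbTE (iset_neqT E)).
have [u [D DE]] := node_parent (vset_node v) vT.
by rewrite -DE QE; apply/esym/cc.
Qed.

End Monomials.

(** * The action of K *)

Section Flip.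
Variable I : finType.
Implicit Types (x : corolla I) (h g : option I) (m : moebius I).

Definition flip h x : corolla I := mk_corolla (valP x) (fun g => col x g (+) (g == h)).

Lemma lin_flip h x : lin (flip h x) =2 lin x.
Proof. by []. Qed.

Lemma col_flip h x g : col (flip h x) g = col x g (+) (g == h).
Proof. exact: col_mk. Qed.

Lemma flip_reflect h x : flip h (reflect_corolla x) = reflect_corolla (flip h x).
Proof.
apply: corolla_lin_eq => [a b|g]; first by rewrite lin_flip !lin_reflect lin_flip.
by rewrite !(col_flip, col_reflect) addNb.
Qed.

Lemma flipK h : involutive (flip h).
Proof.
move=> x; apply: corolla_lin_eq => [a b|g]; first by rewrite !lin_flip.
by rewrite !col_flip -addbA addbb addbF.
Qed.

End Flip.

HB.lock Definition mflip (I : finType) (h : option I) (m : moebius I) : moebius I :=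
  moebius_class (flip h (moebius_repr m)).

Section MoebiusFlip.
Variable I : finType.
Implicit Types (x : corolla I) (h : option I) (m : moebius I).

Lemma mflip_class h x : mflip h (moebius_class x) = moebius_class (flip h x).
Proof.
rewrite mflip.unlock; case/orP: (moebius_repr_iso x) => /eqP-> //.
by rewrite flip_reflect moebius_class_reflect.
Qed.

Lemma mflipK h : involutive (mflip h).
Proof. by move=> m; elim/moebiusW: m => x; rewrite !mflip_class flipK. Qed.

End MoebiusFlip.

Lemma col_unit h : col unit_corolla h = false.
Proof. by rewrite /col /= ffunE. Qed.

(** The basis of K consists of the classes of the identity and of the involution. *)
HB.lock Definition unit_class : moebius unit := moebius_class unit_corolla.
Definition flip_class : moebius unit := mflip None unit_class.

Lemma unit_flip : unit_class != flip_class.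
Proof.
rewrite /flip_class unit_class.unlock mflip_class; apply/eqP => /moebius_classP/orP[]/eqP E.
  by have := congr1 (fun x : corolla _ => col x None) E; rewrite col_flip; case: (col _ _).
have := congr1 (fun x : corolla _ => col x (Some tt)) E.
by rewrite col_reflect col_flip addbF; case: (col _ _).
Qed.

Lemma moebius_unitE (m : moebius unit) : (m == unit_class) || (m == flip_class).
Proof.
elim/moebiusW: m => x; rewrite /flip_class unit_class.unlock mflip_class.
have U (y : corolla unit) : (forall h, col x h = col y h) -> x = y.
  by move=> h; apply: corolla_lin_eq => // -[] []; rewrite !lin_irr.
case a: (col x None); case b: (col x (Some tt)); apply/orP; [left|right|right|left];
  apply/eqP/moebius_classP/orP.
- by right; apply/eqP/U => -[[]|]; rewrite ?a ?b col_reflect col_unit.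
- by left; apply/eqP/U => -[[]|]; rewrite ?a ?b col_flip col_unit.
- by right; apply/eqP/U => -[[]|]; rewrite ?a ?b col_reflect col_flip col_unit.
- by left; apply/eqP/U => -[[]|]; rewrite ?a ?b col_unit.
Qed.

Lemma sum_moebius_unit (V : nmodType) (f : moebius unit -> V) :
  \sum_m f m = f unit_class + f flip_class.
Proof.
have fu : flip_class != unit_class by rewrite eq_sym unit_flip.
rewrite (bigD1 unit_class isT) (bigD1 flip_class fu) big1 => [|m /andP[h1 h2]].
  by change (f unit_class + (f flip_class + 0) = f unit_class + f flip_class); rewrite addr0.
by have := moebius_unitE m; rewrite (negbTE h1) (negbTE h2).
Qed.

Lemma cyc_unit_corolla : cyc (flip None unit_corolla) = set0.
Proof. by []. Qed.

Lemma glue_unit_classl (I : finType) (x : moebius I) (sp : splits tt (@inr unit I)) :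
  moebius_glue sp unit_class x = x.
Proof.
elim/moebiusW: x => x; rewrite unit_class.unlock moebius_glue_class.
exact/moebius_classP/glue_unitl.
Qed.

Lemma glue_unit_classr (I : finType) (i : I) (x : moebius I)
   (sp : splits i (fun a : I => if a == i then inr tt else inl a)) :
  moebius_glue sp x unit_class = x.
Proof. by elim/moebiusW: x => x; rewrite unit_class.unlock moebius_glue_class glue_unitr. Qed.

Lemma glue_flipl (I : finType) (x : moebius I) (sp : splits tt (@inr unit I)) :
  moebius_glue sp flip_class x = mflip None x.
Proof.
elim/moebiusW: x => x; rewrite /flip_class unit_class.unlock !mflip_class moebius_glue_class.
set x' := match_colour tt (flip None unit_corolla) x.
have -> : glue sp (flip None unit_corolla) x = flip None x'.
  have E o : proj_inner (@inr unit I) o = o by case: o.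
  apply: corolla_lin_eq => [a b|h].
    by rewrite lin_flip /lin mem_glue -/x' !E cyc_unit_corolla inE.
  rewrite col_glue -/x' col_flip; case: h => [h|] /=; first by rewrite addbF.
  rewrite /x' /match_colour !col_flip !col_unit /=.
  by case e: (col x None); rewrite /= ?col_reflect e.
by rewrite /x' /match_colour; case: ifP; rewrite // flip_reflect moebius_class_reflect.
Qed.

Lemma glue_flipr (I : finType) (i : I) (x : moebius I)
   (sp : splits i (fun a : I => if a == i then inr tt else inl a)) :
  moebius_glue sp x flip_class = mflip (Some i) x.
Proof.
elim/moebiusW: x => x; rewrite /flip_class unit_class.unlock !mflip_class moebius_glue_class.
congr moebius_class.
have E o : proj_outer i (fun a : I => if a == i then inr tt else inl a) o = o.
  by case: o => [a|] //=; case: eqP => // ->.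
have c0 : cyc (match_colour i x (flip None unit_corolla)) = set0.
  rewrite /match_colour; case: ifP => _ //.
  by apply/setP => -[[a b] c]; rewrite mem_reflect cyc_unit_corolla !inE.
apply: corolla_lin_eq => [a b|h].
  by rewrite lin_flip /lin mem_glue c0 !E inE orbF.
rewrite col_glue col_flip; case: h => [a|]; last by rewrite addbF.
rewrite (inj_eq Some_inj); case: eqP => [->|_]; last by rewrite addbF.
rewrite /match_colour !col_flip !col_unit /=.
by case e: (col x (Some i)); rewrite /= ?col_reflect col_flip col_unit.
Qed.

HB.lock Definition coef (k : fieldType) (I : finType) (x : MAss k I) (m : moebius I) : k :=
  (x : {ffun moebius I -> k^o}) m.

HB.lock Definition monomial (k : fieldType) (I : finType) (m : moebius I) : MAss k I :=
  [ffun w => (w == m)%:R] : {ffun moebius I -> k^o}.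

Section Action.
Variable k : fieldType.
Local Notation K := (MAss k unit).

Lemma coef_inj (I : finType) (x y : MAss k I) : coef x =1 coef y -> x = y.
Proof. by rewrite coef.unlock => h; apply/ffunP. Qed.

Lemma coef_add (I : finType) (x y : MAss k I) m : coef (x + y) m = coef x m + coef y m.
Proof. by rewrite coef.unlock ffunE. Qed.

Lemma coef_scale (I : finType) (a : k) (x : MAss k I) m : coef (a *: x) m = a * coef x m.
Proof. by rewrite coef.unlock ffunE. Qed.

Lemma coef_big (I J : finType) (P : pred J) (f : J -> MAss k I) m :
  coef (\sum_(j | P j) f j) m = \sum_(j | P j) coef (f j) m.
Proof. by rewrite coef.unlock; exact: sum_ffunE. Qed.

Lemma coef_monomial (I : finType) (m w : moebius I) : coef (monomial k m) w = (w == m)%:R.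
Proof. by rewrite coef.unlock monomial.unlock ffunE. Qed.

Lemma monomial_sum (I : finType) (x : MAss k I) : x = \sum_m coef x m *: monomial k m.
Proof.
apply: coef_inj => w; rewrite coef_big (bigD1 w) //= big1 ?addr0.
  by rewrite coef_scale coef_monomial eqxx mulr1.
by move=> m mw; rewrite coef_scale coef_monomial eq_sym (negbTE mw) mulr0.
Qed.

Lemma sum_delta (I : finType) (x : {ffun moebius I -> k^o}) (f : moebius I -> moebius I) m :
  involutive f -> \sum_b x b * (f b == m)%:R = x (f m).
Proof.
move=> fK; rewrite (bigD1 (f m)) //= fK eqxx mulr1 big1 ?addr0 // => b bm.
by rewrite -(inj_eq (inv_inj fK)) fK (negbTE bm) mulr0.
Qed.

Lemma coef_left_act (I : finType) (c : K) (x : MAss k I) m :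
  coef (left_act c x) m =
  coef c unit_class * coef x m + coef c flip_class * coef x (mflip None m).
Proof.
rewrite coef.unlock /left_act /= /mass_comp /lin2 ffunE sum_moebius_unit .
congr (_ + _).
  rewrite -[X in _ * x X]/(id m) -sum_delta // mulr_sumr; apply: eq_bigr => b _.
  by rewrite -mulrA glue_unit_classl.
rewrite -(sum_delta x _ (@mflipK _ _)) mulr_sumr; apply: eq_bigr => b _.
by rewrite -mulrA glue_flipl.
Qed.

Lemma coef_right_act (I : finType) (i : I) (c : K) (x : MAss k I) m :
  coef (right_act i x c) m =
  coef c unit_class * coef x m + coef c flip_class * coef x (mflip (Some i) m).
Proof.
rewrite coef.unlock /right_act /= /mass_comp /lin2 ffunE exchange_big sum_moebius_unit .
congr (_ + _).
  rewrite -[X in _ * x X]/(id m) -sum_delta // mulr_sumr; apply: eq_bigr => b _.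
  by rewrite glue_unit_classr -mulrA mulrCA.
rewrite -(sum_delta x _ (@mflipK _ _)) mulr_sumr; apply: eq_bigr => b _.
by rewrite glue_flipr -mulrA mulrCA.
Qed.

Definition flip_elt : K := monomial k flip_class.

Lemma coef_flip_elt : (coef flip_elt unit_class = 0) * (coef flip_elt flip_class = 1).
Proof. by rewrite /flip_elt !coef_monomial (negbTE unit_flip) eqxx. Qed.

Lemma left_act_flip (I : finType) (m : moebius I) :
  left_act flip_elt (monomial k m) = monomial k (mflip None m).
Proof.
apply: coef_inj => w.
rewrite coef_left_act !coef_flip_elt mul0r mul1r add0r.
rewrite !coef_monomial.
by rewrite -(inj_eq (inv_inj (@mflipK _ None))) mflipK.
Qed.

Lemma right_act_flip (I : finType) (i : I) (m : moebius I) :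
  right_act i (monomial k m) flip_elt = monomial k (mflip (Some i) m).
Proof.
apply: coef_inj => w.
rewrite coef_right_act !coef_flip_elt mul0r mul1r add0r !coef_monomial.
by rewrite -(inj_eq (inv_inj (@mflipK _ (Some i)))) mflipK.
Qed.

Lemma coef_comp (I J L : finType) (i : I) (p : L -> I + J) (sp : splits i p)
    (x : MAss k I) (y : MAss k J) w :
  coef (op_comp sp x y) w =
  \sum_a \sum_b coef x a * coef y b * (moebius_glue sp a b == w)%:R.
Proof. by rewrite coef.unlock /= /mass_comp /lin2 ffunE. Qed.

Lemma sum_monomial (I : finType) (m : moebius I) (f : moebius I -> k) :
  \sum_w coef (monomial k m) w * f w = f m.
Proof.
transitivity (\sum_w if w == m then f w else 0); last by rewrite -big_mkcond big_pred1_eq.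
by apply: eq_bigr => w _; rewrite coef_monomial; case: ifP; rewrite (mul1r, mul0r).
Qed.

Lemma comp_monomial (I J L : finType) (i : I) (p : L -> I + J) (sp : splits i p) a b :
  op_comp sp (monomial k a) (monomial k b) = monomial k (moebius_glue sp a b).
Proof.
apply: coef_inj => w; rewrite coef_comp coef_monomial eq_sym.
transitivity (\sum_a' coef (monomial k a) a' * (moebius_glue sp a' b == w)%:R);
    last exact: sum_monomial.
apply: eq_bigr => a' _.
transitivity (coef (monomial k a) a' *
  \sum_b' coef (monomial k b) b' * (moebius_glue sp a' b' == w)%:R).
  rewrite mulr_sumr; apply: eq_bigr => b' _.
  exact/esym/mulrA.
congr (_ * _).
exact: (sum_monomial b (fun b' => (moebius_glue sp a' b' == w)%:R)).
Qed.

Lemma act_monomial (I J : finType) (f : I -> J) (fB : bijective f) w :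
  op_act fB (monomial k (moebius_pull (bij_inj fB) w)) = monomial k w.
Proof.
apply: coef_inj => w'; rewrite coef.unlock monomial.unlock /= /mass_act !ffunE.
by rewrite (inj_eq (bij_inj (moebius_pull_bij fB))).
Qed.

End Action.

(** * Multilinear functions of a decoration *)

Lemma linear_map_sum (k : fieldType) (U V : lmodType k) (f : U -> V) (J : finType)
  (c : J -> k) (u : J -> U) : linear f ->
  f (\sum_j c j *: u j) = \sum_j c j *: f (u j).
Proof.
move=> lf; have f0 : f 0 = 0.
  by have := lf (-1) 0 0; rewrite scaler0 addr0 scaleN1r addNr.
elim/big_rec2: _ => // j b a _ <-.
by have := lf (c j) (u j) a.
Qed.

Section Multilinear.
Variables (k : fieldType) (P : operad k) (n : nat) (T : tree n).
Implicit Types (x : decoration P T) (v u : vertex T).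

Definition multilinear (f : decoration P T -> P unit) : Prop :=
  forall x v, linear (fun y : P (input v) => f (redecorate x y)).

Lemma redecorate_same x v (y : P (input v)) : redecorate x y v = y.
Proof. exact: dfwith_in. Qed.

Lemma redecorate_other x v u (y : P (input v)) : v != u -> redecorate x y u = x u.
Proof. exact: dfwith_out. Qed.

Lemma redecorateP x v (y : P (input v)) (z : decoration P T) :
  z v = y -> (forall u, v != u -> z u = x u) -> redecorate x y = z.
Proof.
move=> zv zu; apply: functional_extensionality_dep => u.
have [<-|vu] := eqVneq v u; first by rewrite redecorate_same.
by rewrite redecorate_other // zu.
Qed.

End Multilinear.

Section ContractSets.
Variables (n : nat) (T : tree n) (e : edge T).

Definition eset : {set 'I_n} := val e.

Lemma esetP : (eset != setT) /\ (eset \in tset T).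
Proof. by apply/andP; have := proj2_sig e; rewrite /edges 2!inE. Qed.

Lemma tset_contract : tset (contract_tree e) = tset T :\ eset.
Proof. by []. Qed.

Lemma vset_lift (u : vertex (contract_tree e)) : vset (lift_vertex u) = vset u.
Proof. by []. Qed.

Lemma vset_source : vset (edge_source e) = eset.
Proof. by []. Qed.

Lemma lift_neq (u w : vertex (contract_tree e)) : w != u -> lift_vertex w != lift_vertex u.
Proof.
apply: contraNneq => /(congr1 (@vset _ _)); rewrite !vset_lift => wu.
by apply/eqP/vset_inj.
Qed.

Lemma source_neq (u : vertex (contract_tree e)) : edge_source e != lift_vertex u.
Proof.
apply/eqP => /(congr1 (@vset _ _)); rewrite vset_lift vset_source => eu.
by have := vsetP u; rewrite tset_contract 2!inE -eu eqxx.
Qed.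

Lemma lift_ex (v : vertex T) : edge_source e != v ->
    exists w : vertex (contract_tree e), lift_vertex w = v.
Proof.
move=> ev; have vI : vset v \in tset (contract_tree e).
  rewrite tset_contract 2!inE vsetP andbT; apply: contraNneq ev => ve.
  by apply/eqP/vset_inj; rewrite ve.
by have [w wE] := vset_ex vI; exists w; apply: vset_inj; rewrite vset_lift.
Qed.

(** The vertex of the contracted tree that absorbs the edge. *)
Lemma parent_ex : exists p : vertex (contract_tree e), eset \in inputs (tset T) (vset (lift_vertex p)).
Proof.
have [eT _] := esetP; rewrite -vset_source in eT.
have [u [D DE]] := node_parent (vset_node (edge_source e)) eT.
have [|p pu] := @lift_ex u; last by exists p; rewrite pu -vset_source -DE isetP.
apply: contraTneq (iset_proper D) => /(congr1 (@vset _ _)) eu.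
by rewrite DE eu properxx.
Qed.

Lemma parent_contract_uniq (p u : vertex (contract_tree e)) :
  eset \in inputs (tset T) (vset (lift_vertex p)) ->
  eset \in inputs (tset T) (vset (lift_vertex u)) -> p = u.
Proof.
move=> /iset_ex[D DE] /iset_ex[D' DE'].
have /(congr1 (@vset _ _)) := parent_uniq (etrans DE (esym DE')).
by rewrite !vset_lift; exact: vset_inj.
Qed.

End ContractSets.

Section ContractMultilinear.
Variables (k : fieldType) (P : operad k) (n : nat) (T : tree n) (e : edge T).

Lemma contract_parent (x : decoration P T) (u : vertex (contract_tree e))
    (ev : val e \in inputs (val T) (val (lift_vertex u))) :
  contract x u = op_comp (split_input_splits ev) (x (lift_vertex u)) (x (edge_source e)).
Proof.
rewrite /contract; move: (boolP _) => a.
refine (match a as a' in alt_spec _ _ b' return match a' with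
  | AltTrue ev0 => op_comp (split_input_splits ev0) (x (lift_vertex u)) (x (edge_source e))
  | AltFalse ev0 => op_act (push_input_bij ev0) (x (lift_vertex u)) end = _ with
  AltTrue ev0 => _ | AltFalse ev0 => _ end).
  by rewrite (bool_irrelevance ev0 ev).
by case/negP: ev0.
Qed.

Lemma contract_other (x : decoration P T) (u : vertex (contract_tree e))
    (ev : val e \notin inputs (val T) (val (lift_vertex u))) :
  contract x u = op_act (push_input_bij ev) (x (lift_vertex u)).
Proof.
rewrite /contract; move: (boolP _) => a.
refine (match a as a' in alt_spec _ _ b' return match a' with
  | AltTrue ev0 => op_comp (split_input_splits ev0) (x (lift_vertex u)) (x (edge_source e))
  | AltFalse ev0 => op_act (push_input_bij ev0) (x (lift_vertex u)) end = _ with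
  AltTrue ev0 => _ | AltFalse ev0 => _ end).
  by case/negP: ev.
by rewrite (bool_irrelevance ev0 ev).
Qed.

(** Each vertex of T affects only the vertex of T/e that it ends up in, whose
decoration depends linearly on it. *)
Lemma contract_multilinear (f : decoration P (contract_tree e) -> P unit) :
  multilinear f -> multilinear (fun x : decoration P T => f (contract x)).
Proof.
move=> fL x v.
suff [w [yw g]] : exists w : vertex (contract_tree e),
    (forall y (u : vertex (contract_tree e)), w != u ->
      contract (e := e) (redecorate x (v := v) y) u = contract (e := e) x u) /\
    linear (fun y : P (input v) => contract (e := e) (redecorate x y) w).
  move=> a y z /=.
  have E y' : contract (e := e) (redecorate x (v := v) y') =
    redecorate (contract x) (contract (e := e) (redecorate x y') w).
    by apply/esym/redecorateP => // u /yw.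
  by rewrite (E (a *: y + z)) (E y) (E z) g; exact: fL.
have [ve|ve] := eqVneq (edge_source e) v.
  have [p pe] := parent_ex e.
  exists p; split=> [y u pu|].
    have [ev|ev] := boolP (val e \in inputs (val T) (val (lift_vertex u))).
      by case/eqP: pu; apply: parent_contract_uniq pe ev.
    by rewrite !(contract_other _ ev) redecorate_other // -ve source_neq.
  subst v => a y z /=; rewrite !(contract_parent _ pe).
  rewrite !redecorate_same !redecorate_other ?source_neq //.
  exact: op_comp_linearr.
have [w wv] := lift_ex ve; subst v; exists w; split=> [y u wu|].
  have [ev|ev] := boolP (val e \in inputs (val T) (val (lift_vertex u))).
    rewrite !(contract_parent _ ev) (redecorate_other _ _ (lift_neq wu)).
    by rewrite redecorate_other // eq_sym.
  by rewrite !(contract_other _ ev) (redecorate_other _ _ (lift_neq wu)).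
move=> a y z; have [ev|ev] := boolP (val e \in inputs (val T) (val (lift_vertex w))).
  rewrite !(contract_parent _ ev) !redecorate_same !redecorate_other 1?eq_sym //.
  exact: op_comp_linearl.
by rewrite !(contract_other _ ev) !redecorate_same op_act_linear.
Qed.

End ContractMultilinear.

Lemma dC_multilinear (k : fieldType) (P : operad k) n (phi : cochain P n) (T : tree n) :
  (forall T', multilinear (phi T')) -> multilinear (dC phi (T := T)).
Proof.
move=> phiL x v a y z; rewrite /dC scaler_sumr -big_split; apply: eq_bigr => e _ /=.
have := contract_multilinear (e := e) (phiL (contract_tree e)) x a y z => /= ->.
by rewrite scalerDr !scalerA mulrC.
Qed.

Section MAssMultilinear.
Variables (k : fieldType) (n : nat) (T : tree n).

(** The vertices are expanded one by one in the basis of corollas; in the proof, S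
is the set of those that remain. *)
Lemma multilinear_ext (f g : decoration (MAss k) T -> MAss k unit) :
  multilinear f -> multilinear g ->
  (forall m : forall v : vertex T, moebius (input v),
     f (fun v => monomial k (m v)) = g (fun v => monomial k (m v))) ->
  forall x, f x = g x.
Proof.
move=> fL gL fg x.
suff main d : forall (S : {set vertex T}) x, #|S| = d ->
    (forall v, v \notin S -> exists m, x v = monomial k m) -> f x = g x.
  by apply: (main _ setT) => // v; rewrite inE.
elim: d => [|d IH] S y Sd yS.
  have [v|m mE] := @fin_all_exists _ _ (fun v m => y v = monomial k m).
    by apply: yS; rewrite (cards0_eq Sd) inE.
  have -> : y = fun v => monomial k (m v) by apply: functional_extensionality_dep.
  exact: fg.
have [v vS] : exists v, v \in S by apply/set0Pn; rewrite -card_gt0 Sd.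
have yE : y = redecorate y (y v) by apply/esym/redecorateP.
rewrite yE (monomial_sum (y v)).
rewrite (linear_map_sum _ _ (fL y v)) (linear_map_sum _ _ (gL y v)).
apply: eq_bigr => m _; congr (_ *: _); apply: (IH (S :\ v)).
  by move: Sd; rewrite (cardsD1 v) vS => -[].
move=> u; rewrite !inE negb_and negbK => uS.
have [vu|vu] := eqVneq v u; first by subst u; exists m; rewrite redecorate_same.
rewrite redecorate_other //; apply: yS; move: uS; rewrite eq_sym (negbTE vu) //.
Qed.

End MAssMultilinear.

(** * Contraction of planar monomials *)

Definition planar_decoration (k : fieldType) n (T : tree n) (s : {perm 'I_n}) (Q : {set {set 'I_n}}) :
  decoration (MAss k) T := fun v => monomial k (moebius_class (planar_corolla s Q v)).
Arguments planar_decoration k {n} T s Q v.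

Section ContractStd.
Variables (k : fieldType) (n : nat) (T : tree n) (e : edge T).
Variables (s : {perm 'I_n}) (Q : {set {set 'I_n}}) (pl : planar T s).

Lemma planar_contract : planar (contract_tree e) s.
Proof.
apply/forall_inP => D; rewrite tset_contract inE => /andP[_].
exact: (forall_inP pl).
Qed.

Section Parent.
Variables (v : vertex (contract_tree e)) (ev : val e \in inputs (val T) (val (lift_vertex v))).

Definition side_set (h : input (lift_vertex v) + input (edge_source e)) : {set 'I_n} :=
  match h with inl a => iset a | inr b => iset b end.

Lemma iset_split (D : input v) : iset D = side_set (split_input ev D).
Proof.
rewrite /side_set /split_input /iset; case: insubP => [b _ -> //|] /= nD.
rewrite val_insubd; case: ifP => // /negP[].
have := proj2_sig D => /= h.
by move: (mem_input_contract ev (sval D));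
    rewrite (negbTE nD) orbF -[sval D]/(val D) h => /esym/andP[].
Qed.

Lemma iset_splitl (D : input v) a : split_input ev D = inl a -> iset D = iset a.
Proof. by move=> Da; rewrite iset_split Da. Qed.

Lemma iset_splitr (D : input v) b : split_input ev D = inr b -> iset D = iset b.
Proof. by move=> Db; rewrite iset_split Db. Qed.

Lemma split_neq_parent (D : input v) a : split_input ev D = inl a -> a != parent_input ev.
Proof.
have [_ splitC] := split_input_splits ev; move=> Da.
have := codom_f (split_input ev) D; rewrite splitC Da.
by apply: contraNneq => ->.
Qed.

Lemma iset_parent_input : iset (parent_input ev) = eset e.
Proof. by []. Qed.

Lemma lin_parent (D D' : input v) a b :
  split_input ev D = inl a -> split_input ev D' = inr b ->
  lin (planar_corolla s Q v) D D' = lin (planar_corolla s Q (lift_vertex v)) a (parent_input ev) /\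
  lin (planar_corolla s Q v) D' D = lin (planar_corolla s Q (lift_vertex v)) (parent_input ev) a.
Proof.
move=> Da D'b.
have DE := iset_splitl Da.
have D'E := iset_splitr D'b.
have DD' : D != D' by apply/eqP => DD; rewrite DD D'b in Da.
have [l la] := node_leaf (iset_node a); have [m mb] := node_leaf (iset_node b).
have me : m \in iset (parent_input ev).
  by rewrite iset_parent_input -vset_source; exact: subsetP (iset_sub b) _ mb.
have ap : a != parent_input ev.
  exact: split_neq_parent Da.
have lD : l \in iset D by rewrite DE.
have mD' : m \in iset D' by rewrite D'E.
split; first by rewrite (lin_planar s Q D D') (lin_planar s Q a (parent_input ev)) (iset_key planar_contract DD' lD mD') (iset_key pl ap la me).
rewrite eq_sym in ap; rewrite eq_sym in DD'.
by rewrite (lin_planar s Q D' D) (lin_planar s Q (parent_input ev) a) (iset_key planar_contract DD' mD' lD) (iset_key pl ap me la).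
Qed.

(** The inputs of both ends of the edge are compared in the one order s, an input
of the parent and one of e as at the parent; the halves of the edge have the
same colour, so that no reflection is needed. *)
Lemma glue_planar : glue (split_input_splits ev) (planar_corolla s Q (lift_vertex v))
    (planar_corolla s Q (edge_source e)) = planar_corolla s Q v.
Proof.
have M : match_colour (parent_input ev) (planar_corolla s Q (lift_vertex v)) (planar_corolla s Q (edge_source e)) =
         planar_corolla s Q (edge_source e).
  by rewrite /match_colour !col_planar iset_parent_input vset_source eqxx.
apply: corolla_lin_eq => [D D'|[D|]]; last first.
- by rewrite col_glue !col_planar vset_lift.
- rewrite col_glue M (col_planar s Q (Some D)); case Da: (split_input ev D) => [a|b].
    by rewrite (col_planar s Q (Some a)) (iset_splitl Da).
  by rewrite (col_planar s Q (Some b)) (iset_splitr Da).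
rewrite /lin mem_glue M /proj_outer /proj_inner.
case Da: (split_input ev D) => [a|b]; case D'a: (split_input ev D') => [a'|b'].
- rewrite [X in _ || X]cyc_degenerate ?orbF; last by left.
  rewrite -[LHS]/(lin (planar_corolla s Q (lift_vertex v)) a a') -[RHS]/(lin (planar_corolla s Q v) D D').
  by rewrite (lin_planar s Q a a') (lin_planar s Q D D') (iset_splitl Da) (iset_splitl D'a).
- rewrite [X in _ || X]cyc_degenerate ?orbF; last by left.
  exact: esym (proj1 (lin_parent Da D'a)).
- rewrite [X in _ || X]cyc_degenerate ?orbF; last by right; right.
  exact: esym (proj2 (lin_parent D'a Da)).
- rewrite [X in X || _]cyc_degenerate ?orFb; last by right; left.
  rewrite -[LHS]/(lin (planar_corolla s Q (edge_source e)) b b') -[RHS]/(lin (planar_corolla s Q v) D D').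
  by rewrite (lin_planar s Q b b') (lin_planar s Q D D') (iset_splitr Da) (iset_splitr D'a).
Qed.

End Parent.

Lemma contract_planar : contract (e := e) (planar_decoration k T s Q) =
    planar_decoration k (contract_tree e) s Q.
Proof.
apply: functional_extensionality_dep => v.
have [ev|ev] := boolP (val e \in inputs (val T) (val (lift_vertex v))).
  by rewrite (contract_parent _ ev) /planar_decoration comp_monomial moebius_glue_class glue_planar.
rewrite (contract_other _ ev) /planar_decoration.
suff -> : moebius_class (planar_corolla s Q (lift_vertex v)) =
    moebius_pull (bij_inj (push_input_bij ev)) (moebius_class (planar_corolla s Q v)).
  by rewrite act_monomial.
rewrite moebius_pull_class; congr moebius_class.
have E (D : input (lift_vertex v)) : iset (push_input ev D) = iset D by [].
apply: corolla_lin_eq => [D D'|h].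
  by rewrite lin_planar /lin mem_pull -/(lin _ _ _) lin_planar !E.
by rewrite col_pull !col_planar; case: h => [D|] /=; rewrite ?E ?vset_lift.
Qed.

End ContractStd.

(** * The dual of the space of decorations *)

Definition flip_colour (A : finType) (a : A) (X : {set A}) : {set A} :=
    [set b | (b == a) (+) (b \in X)].

Lemma in_flip_colour (A : finType) (a b : A) (X : {set A}) : (b \in flip_colour a X) =
    (b == a) (+) (b \in X).
Proof. by rewrite inE. Qed.

Lemma flip_colourK (A : finType) (a : A) : involutive (flip_colour a).
Proof. by move=> X; apply/setP => b; rewrite !inE addbA addbb. Qed.

Section Flips.
Variables (n : nat) (T : tree n).
Implicit Types (s : {perm 'I_n}) (v u w : vertex T) (D E : {set 'I_n}) (Q : {set {set 'I_n}}).

Definition leaf_colours Q : {set 'I_n} := [set l | [set l] \in Q].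

Lemma in_leaf_colours Q l : (l \in leaf_colours Q) = ([set l] \in Q).
Proof. by rewrite inE. Qed.

Definition singletons (L : {set 'I_n}) : {set {set 'I_n}} := [set [set l] | l in L].

Lemma singletonsK L : leaf_colours (singletons L) = L.
Proof. by apply/setP => l; rewrite inE mem_imset //; exact: set1_inj. Qed.

Lemma planar_corolla_eq s Q Q' v : (forall D : input v, (iset D \in Q) = (iset D \in Q')) ->
  (vset v \in Q) = (vset v \in Q') -> planar_corolla s Q v = planar_corolla s Q' v.
Proof. by move=> h1 h2; apply: planar_corolla_ext. Qed.

Lemma flip_input_planar s Q v (E : input v) :
  flip (Some E) (planar_corolla s Q v) = planar_corolla s (flip_colour (iset E) Q) v.
Proof.
apply: corolla_lin_eq => [D D'|[D|]]; first by rewrite lin_flip !lin_planar.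
  by rewrite col_flip !col_planar inE addbC (inj_eq (@Some_inj _)) (inj_eq (@iset_inj _ _ v)).
rewrite col_flip !col_planar inE addbC; rewrite (_ : (vset v == iset E) = false) //; apply/negbTE.
by apply: contraTneq (iset_proper E) => ->; rewrite properxx.
Qed.

Lemma flip_output_planar s Q v : flip None (planar_corolla s Q v) =
    planar_corolla s (flip_colour (vset v) Q) v.
Proof.
apply: corolla_lin_eq => [D D'|[D|]]; first by rewrite lin_flip !lin_planar.
  rewrite col_flip !col_planar inE addbC; rewrite (_ : (iset D == vset v) = false) //; apply/negbTE.
  by apply: contraTneq (iset_proper D) => ->; rewrite properxx.
by rewrite col_flip !col_planar inE addbC !eqxx.
Qed.

(** Only the two ends of an edge see its colour. *)
Lemma planar_flip_other s Q v w u (E : input v) : iset E = vset w -> u != v -> u != w ->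
  planar_corolla s (flip_colour (vset w) Q) u = planar_corolla s Q u.
Proof.
move=> Ew uv uw; apply: planar_corolla_eq => [D|]; rewrite inE.
  rewrite [_ == _](_ : _ = false) //; apply: contraNF uv => /eqP Dw.
  by apply/eqP; apply: (@parent_uniq _ _ _ _ D E); rewrite Dw Ew.
rewrite [_ == _](_ : _ = false) //; apply: contraNF uw => /eqP /vset_inj ->; exact: eqxx.
Qed.

Lemma planar_flip_root s Q u : u != root_vertex T -> planar_corolla s (flip_colour setT Q) u =
    planar_corolla s Q u.
Proof.
move=> uT; apply: planar_corolla_eq => [D|]; rewrite inE.
  by rewrite (negbTE (iset_neqT D)).
rewrite [_ == _](_ : _ = false) //; apply: contraNF uT => /eqP uT.
by apply/eqP/vset_inj; rewrite uT root_vset.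
Qed.

Lemma rev_permK : involutive (@rev_perm n).
Proof. by move=> s; apply/permP => l; rewrite !rev_permE rev_ordK. Qed.

Lemma planar_rev s : planar T (rev_perm s) = planar T s.
Proof.
suff main t : planar T t -> planar T (rev_perm t).
  by apply/idP/idP => [/main|/main//]; rewrite rev_permK.
move=> pl; apply/forall_inP => D /(forall_inP pl)/convexP h; apply/convexP => a b c aD bD cD.
have ne x : x \in D -> t c != t x :> nat.
  by move=> xD; rewrite (inj_eq val_inj) (inj_eq perm_inj); apply: contraNneq cD => ->.
have := h _ _ _ aD bD cD; have := ne _ aD; have := ne _ bD.
rewrite !rev_permE /=; have := ltn_ord (t a); have := ltn_ord (t b); have := ltn_ord (t c); lia.
Qed.

Lemma class_planar_rev s Q v :
  moebius_class (planar_corolla (rev_perm s) (~: Q) v) = moebius_class (planar_corolla s Q v).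
Proof. by rewrite -planar_corolla_reflect moebius_class_reflect. Qed.

End Flips.

(** K-linear functions are recovered from their coefficient at 1: the other one
is the coefficient at 1 of the reflected monomial. *)
Definition colour_coef (k : fieldType) n (G : {perm 'I_n} -> {set 'I_n} -> k)
    (s : {perm 'I_n}) (L : {set 'I_n}) (m : moebius unit) : k :=
  if m == unit_class then G s L else G (rev_perm s) (~: L).

Section DualValues.
Variables (k : fieldType) (n : nat) (n1 : (1 < n)%N) (T : tree n).
Variables (phi : decoration (MAss k) T -> MAss k unit) (phiD : in_dual phi).
Implicit Types (s : {perm 'I_n}) (v u w : vertex T) (D E : {set 'I_n}) (Q : {set {set 'I_n}}).

Lemma dual_balanced (x : decoration (MAss k) T) v w (E : input v) (c : MAss k unit) :
  iset E = vset w ->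
  phi (redecorate x (right_act E (x v) c)) = phi (redecorate x (left_act c (x w))).
Proof.
move=> Ew; have [_ bal _] := phiD.
have wv : val w \in inputs (val T) (val v) by have := isetP E; rewrite Ew.
suff <- : (Sub (val w) wv : input v) = E by exact: bal.
by apply: iset_inj; rewrite Ew.
Qed.

(** The generator of K, applied at the upper end of the edge and moved across it,
flips the colours of both halves. *)
Lemma dual_flip_colour s Q w : vset w != setT ->
  phi (planar_decoration k T s (flip_colour (vset w) Q)) = phi (planar_decoration k T s Q).
Proof.
move=> wT.
have [v [E Ew]] := node_parent (vset_node w) wT.
have vw : v != w by apply: contraTneq (iset_proper E) => vw; rewrite Ew vw properxx.
pose x := @redecorate _ _ _ T (planar_decoration k T s Q) v (planar_decoration k T s (flip_colour (vset w) Q) v).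
have := dual_balanced x (flip_elt k) Ew.
have -> : redecorate x (right_act E (x v) (flip_elt k)) = planar_decoration k T s Q.
  apply: redecorateP => [|u vu]; last by rewrite /x redecorate_other.
  by rewrite /x redecorate_same right_act_flip mflip_class flip_input_planar Ew flip_colourK.
have -> : redecorate x (left_act (flip_elt k) (x w)) =
    planar_decoration k T s (flip_colour (vset w) Q).
  apply: redecorateP => [|u wu].
    by rewrite /x redecorate_other // left_act_flip mflip_class flip_output_planar.
  have [<-|vu] := eqVneq v u; first by rewrite /x redecorate_same.
  by rewrite /x redecorate_other // /planar_decoration (planar_flip_other _ _ Ew) // eq_sym.
by move=> ->.
Qed.

(** The colours of the inner edges are made 0 one after the other. *)
Lemma dual_leaf_colours s Q : setT \notin Q ->
  phi (planar_decoration k T s Q) = phi (planar_decoration k T s (singletons (leaf_colours Q))).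
Proof.
move: {2}#|_| (leqnn #|Q :&: tset T|) => d; elim: d Q => [|d IH] Q Qd QT.
  congr phi; apply: functional_extensionality_dep => v; congr (monomial k (moebius_class _)).
  have QN D : D \in nodes (tset T) -> (D \in Q) = (D \in singletons (leaf_colours Q)).
    rewrite inE => /orP[DT|/imsetP[l _ ->]]; last by rewrite mem_imset ?inE //; exact: set1_inj.
    have -> : (D \in Q) = false.
      by apply: contraTF Qd => DQ; rewrite -ltnNge card_gt0; apply/set0Pn; exists D; rewrite inE DQ.
    apply/esym/negbTE/imsetP => -[l _ Dl].
    by have := singleton_notin_tset T l; rewrite -Dl DT.
  by apply: planar_corolla_eq => [D|]; apply: QN; [exact: iset_node|exact: vset_node].
have [Q0|/set0Pn[D]] := eqVneq (Q :&: tset T) set0; first by apply: IH; rewrite // Q0 cards0.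
rewrite inE => /andP[DQ /vset_ex[w wD]].
have wT : vset w != setT by rewrite wD; apply: contraNneq QT => <-.
rewrite -(dual_flip_colour _ _ wT) wD.
have -> : leaf_colours Q = leaf_colours (flip_colour D Q).
  apply/setP => l; rewrite !inE; case: eqP => // lD.
  by have := vsetP w; rewrite wD -lD (negbTE (singleton_notin_tset T l)).
apply: IH; last by rewrite inE (negbTE QT) -wD eq_sym (negbTE wT).
rewrite -ltnS; apply: leq_trans Qd; apply: proper_card; apply/properP; split.
  by apply/subsetP => E; rewrite !inE; case: eqP => [->|]; rewrite ?DQ.
by exists D; rewrite !inE ?DQ -?wD ?vsetP ?eqxx.
Qed.

Definition dual_coef s (L : {set 'I_n}) : k :=
  coef (phi (planar_decoration k T s (singletons L))) unit_class.

Lemma setT_notin_singletons (L : {set 'I_n}) : setT \notin singletons L.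
Proof. by apply/imsetP => -[l _ /eqP]; rewrite eq_sym (negbTE (set1_neqT l n1)). Qed.

(** The generator of K flips the output; reflecting all the corollas then brings
the output back to colour 0, reverses the order and flips the other colours. *)
Lemma dual_flip s L : coef (phi (planar_decoration k T s (singletons L))) flip_class =
  dual_coef (rev_perm s) (~: L).
Proof.
have [_ _ rt] := phiD; pose Q := singletons L; have QT : setT \notin Q := setT_notin_singletons L.
have := rt (planar_decoration k T s Q) (flip_elt k).
have -> : redecorate (planar_decoration k T s Q) (left_act (flip_elt k) (planar_decoration k T s Q (root_vertex T))) =
   planar_decoration k T (rev_perm s) (~: flip_colour setT Q).
  apply: redecorateP => [|u ru].
    by rewrite left_act_flip mflip_class flip_output_planar root_vset /planar_decoration class_planar_rev.
  by rewrite /planar_decoration class_planar_rev planar_flip_root // eq_sym.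
rewrite dual_leaf_colours; last by rewrite !inE eqxx (negbTE QT).
have -> : leaf_colours (~: flip_colour setT Q) = ~: L.
  apply/setP => l; rewrite -[in RHS](singletonsK L) !inE (negbTE (set1_neqT l n1)) //.
move/(congr1 (fun y => coef y unit_class)); rewrite /dual_coef => ->.
by rewrite coef_left_act !coef_flip_elt mul0r mul1r add0r.
Qed.

Lemma dual_planar s Q m : setT \notin Q ->
  coef (phi (planar_decoration k T s Q)) m = colour_coef dual_coef s (leaf_colours Q) m.
Proof.
move=> QT; rewrite dual_leaf_colours // /colour_coef; case: eqP => [->//|/eqP m1].
by have := moebius_unitE m; rewrite (negbTE m1) => /eqP->; rewrite dual_flip.
Qed.

End DualValues.

Section DualFunctional.
Variables (k : fieldType) (n : nat) (n1 : (1 < n)%N) (T : tree n).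
Variable G : {perm 'I_n} -> {set 'I_n} -> k.
Implicit Types (s : {perm 'I_n}) (v u w : vertex T) (D E : {set 'I_n}) (Q : {set {set 'I_n}}).
Implicit Types (x : decoration (MAss k) T) (p : {perm 'I_n} * {set {set 'I_n}}).

Definition planar_colouring p : bool :=
  [&& planar T p.1, p.2 \subset nodes (tset T) & setT \notin p.2].

Definition term x p v : k := coef (x v) (moebius_class (planar_corolla p.1 p.2 v)).

(** The function with the value G s L at every planar monomial with order s, leaf
colours L and output of colour 0, whatever the colours of the inner edges: x is
expanded in corollas, and each combination of isomorphism classes of corollas
is that of one planar monomial. *)
Definition dual_of x : MAss k unit :=
  [ffun m => \sum_(p | planar_colouring p)
     (\prod_v term x p v) * colour_coef G p.1 (leaf_colours p.2) m] : {ffun moebius unit -> k^o}.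

Lemma coef_dual_of x m : coef (dual_of x) m =
  \sum_(p | planar_colouring p) (\prod_v term x p v) * colour_coef G p.1 (leaf_colours p.2) m.
Proof. by rewrite coef.unlock /dual_of ffunE. Qed.

Lemma term_same x p v (y : MAss k (input v)) :
  term (redecorate x y) p v = coef y (moebius_class (planar_corolla p.1 p.2 v)).
Proof. by rewrite /term redecorate_same. Qed.

Lemma term_other x p v u (y : MAss k (input v)) : v != u ->
  term (redecorate x y) p u = term x p u.
Proof. by move=> vu; rewrite /term redecorate_other. Qed.

Lemma prod_split (f g h : vertex T -> k) v (a b : k) :
  f v = a * g v + b * h v -> (forall u, v != u -> f u = g u) -> (forall u, v != u -> f u = h u) ->
  \prod_u f u = a * \prod_u g u + b * \prod_u h u.
Proof.
move=> fv fg fh; rewrite (bigD1 v isT) [X in a * X](bigD1 v isT) [X in b * X](bigD1 v isT) /=.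
have -> : \prod_(u | u != v) g u = \prod_(u | u != v) f u.
  by apply: eq_bigr => u uv; rewrite fg // eq_sym.
have -> : \prod_(u | u != v) h u = \prod_(u | u != v) f u.
  by apply: eq_bigr => u uv; rewrite fh // eq_sym.
by rewrite fv mulrDl !mulrA.
Qed.

Lemma dual_of_multilinear : multilinear dual_of.
Proof.
move=> x v a y z; apply: coef_inj => m.
rewrite coef_add coef_scale !coef_dual_of mulr_sumr -big_split; apply: eq_bigr => p _ /=.
rewrite mulrA -mulrDl; congr (_ * _).
rewrite -[X in _ = _ + X]mul1r; apply: (prod_split (v := v)) => [|u vu|u vu].
- by rewrite !term_same coef_add coef_scale mul1r.
- by rewrite !term_other.
- by rewrite !term_other.
Qed.

Definition swap_term x p q v u : k := if u == v then term x q u else term x p u.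

Lemma prod_swap x p q v (y : MAss k (input v)) a b :
  coef y (moebius_class (planar_corolla p.1 p.2 v)) = a * term x p v + b * term x q v ->
  \prod_u term (redecorate x y) p u = a * \prod_u term x p u + b * \prod_u swap_term x p q v u.
Proof.
move=> yE; apply: (prod_split (v := v)) => [|u vu|u vu].
- by rewrite term_same yE /swap_term eqxx.
- by rewrite term_other.
- by rewrite term_other // /swap_term eq_sym (negbTE vu).
Qed.

Lemma leaf_colours_flip w Q : leaf_colours (flip_colour (vset w) Q) = leaf_colours Q.
Proof.
apply/setP => l; rewrite !inE; case: eqP => // lw.
by have := vsetP w; rewrite -lw (negbTE (singleton_notin_tset T l)).
Qed.

(** Flipping the colour of the edge above w permutes the colourings and exchanges
the effects of the generator of K at the two ends. *)
Lemma dual_of_balanced x v w (E : input v) (c : MAss k unit) : iset E = vset w ->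
  dual_of (redecorate x (right_act E (x v) c)) = dual_of (redecorate x (left_act c (x w))).
Proof.
move=> Ew; pose tg p := (p.1, flip_colour (vset w) p.2).
have tgK : involutive tg by case=> s Q; rewrite /tg /= flip_colourK.
have wT : vset w != setT by rewrite -Ew iset_neqT.
have vw : v != w by apply: contraTneq (iset_proper E) => vw; rewrite Ew vw properxx.
have tgP p : planar_colouring (tg p) = planar_colouring p.
  rewrite /planar_colouring /= inE eq_sym (negbTE wT); congr [&& _, _ & _].
  apply/subsetP/subsetP => h D; have := h D; rewrite !inE; case: eqP => [->|_] //= _ _;
    by rewrite vsetP.
apply: coef_inj => m; rewrite !coef_dual_of.
pose g p := colour_coef G p.1 (leaf_colours p.2) m.
transitivity (\sum_(p | planar_colouring p) (coef c unit_class * \prod_u term x p u) * g p +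
  \sum_(p | planar_colouring p) (coef c flip_class * \prod_u swap_term x p (tg p) v u) * g p).
  rewrite -big_split; apply: eq_bigr => p _ /=; rewrite -mulrDl; congr (_ * _).
  by apply: prod_swap; rewrite coef_right_act mflip_class flip_input_planar Ew.
transitivity (\sum_(p | planar_colouring p) (coef c unit_class * \prod_u term x p u) * g p +
  \sum_(p | planar_colouring p) (coef c flip_class * \prod_u swap_term x p (tg p) w u) * g p);
      last first.
  rewrite -big_split; apply: eq_bigr => p _ /=; rewrite -mulrDl; congr (_ * _).
  by apply/esym/prod_swap; rewrite coef_left_act mflip_class flip_output_planar.
congr (_ + _); rewrite (reindex_inj (inv_inj tgK)) /=; apply: eq_big => p; first exact: tgP.
move=> _; rewrite /g /= leaf_colours_flip; congr (_ * _ * _); apply: eq_bigr => u _.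
rewrite /swap_term tgK; have [->|uv] := eqVneq u v; first by rewrite (negbTE vw).
have [//|uw] := eqVneq u w.
by rewrite /term /= (planar_flip_other _ _ Ew).
Qed.

Lemma colour_coef_rev s L m :
  colour_coef G (rev_perm s) (~: L) m = colour_coef G s L (mflip None m).
Proof.
rewrite /colour_coef; case/orP: (moebius_unitE m) => /eqP->.
  by rewrite eqxx -/flip_class eq_sym (negbTE unit_flip).
by rewrite eq_sym (negbTE unit_flip) mflipK eqxx rev_permK setCK.
Qed.

(** The output is flipped, and then every corolla reflected: this is how the
generator of K acts on the planar monomials with output of colour 0. *)
Definition mirror p := (rev_perm p.1, nodes (tset T) :&: ~: flip_colour setT p.2).

Lemma mirrorP p : planar_colouring p -> planar_colouring (mirror p).
Proof.
case/and3P=> pl QN QT; apply/and3P; split; rewrite /= ?planar_rev ?subsetIl //.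
by rewrite !inE eqxx (negbTE QT) andbF.
Qed.

Lemma mirrorK p : planar_colouring p -> mirror (mirror p) = p.
Proof.
case: p => s Q /and3P[/= _ QN QT]; rewrite /mirror /= rev_permK; congr (_, _).
apply/setP => D; rewrite in_setI in_setC in_flip_colour in_setI in_setC in_flip_colour.
have [DN|DN] := boolP (D \in nodes (tset T)); last by apply/esym/negbTE; apply: contra DN;
    exact: (subsetP QN).
have [->|DT] := eqVneq D setT; first by rewrite (negbTE QT).
by rewrite !addFb negbK.
Qed.

Lemma term_mirror x p u : term x (mirror p) u =
    swap_term x p (p.1, flip_colour setT p.2) (root_vertex T) u.
Proof.
have -> : term x (mirror p) u = term x (p.1, flip_colour setT p.2) u.
  rewrite /term /= -(class_planar_rev p.1 (flip_colour setT p.2)); congr (coef _ (moebius_class _)).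
  by apply: planar_corolla_eq => [D|]; rewrite in_setI ?iset_node ?vset_node.
rewrite /swap_term; case: eqP => // /eqP uT.
by rewrite /term /= planar_flip_root.
Qed.

Lemma dual_of_root x (c : MAss k unit) :
  dual_of (redecorate x (left_act c (x (root_vertex T)))) = left_act c (dual_of x).
Proof.
apply: coef_inj => m; rewrite coef_left_act !coef_dual_of !mulr_sumr.
transitivity (\sum_(p | planar_colouring p)
    (coef c unit_class * ((\prod_u term x p u) * colour_coef G p.1 (leaf_colours p.2) m)) +
  \sum_(p | planar_colouring p)
    (coef c flip_class * ((\prod_u term x (mirror p) u) * colour_coef G p.1 (leaf_colours p.2) m))).
  rewrite -big_split; apply: eq_bigr => p _ /=; rewrite !mulrA -mulrDl; congr (_ * _).
  under [X in _ = _ + _ * X]eq_bigr do rewrite term_mirror.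
  by apply: prod_swap; rewrite coef_left_act mflip_class flip_output_planar root_vset.
apply: (congr1 (fun z => \sum_(p | planar_colouring p) (coef c unit_class *
  ((\prod_u term x p u) * colour_coef G p.1 (leaf_colours p.2) m)) + z)).
rewrite [LHS](@reindex_onto _ _ _ _ _ mirror mirror planar_colouring _ mirrorK).
apply: eq_big => [p|p /andP[_ /eqP pK]].
  apply/andP/idP => [[mp /eqP pK]|Pp]; first by rewrite -pK mirrorP.
  by rewrite mirrorP // mirrorK.
rewrite pK -colour_coef_rev.
suff -> : leaf_colours (mirror p).2 = ~: leaf_colours p.2 by [].
apply/setP => l; rewrite in_setC !in_leaf_colours in_setI in_setC in_flip_colour (negbTE (set1_neqT l n1)) /=.
by rewrite [_ \in nodes _]inE imset_f ?orbT.
Qed.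

Lemma dual_of_in_dual : in_dual dual_of.
Proof.
split; [exact: dual_of_multilinear| |exact: dual_of_root].
by move=> x v w wv c; apply: dual_of_balanced.
Qed.

(** The basis expansion of a planar monomial has a single term. *)
Lemma dual_of_planar p m : planar_colouring p ->
  coef (dual_of (planar_decoration k T p.1 p.2)) m = colour_coef G p.1 (leaf_colours p.2) m.
Proof.
move=> Pp; rewrite coef_dual_of (bigD1 p Pp) /= [X in _ + X]big1 => [|q /andP[Pq qp]].
  rewrite addr0 big1 ?mul1r // => v _.
  by rewrite /term /planar_decoration coef_monomial eqxx.
suff [v vE] : exists v, moebius_class (planar_corolla q.1 q.2 v) != moebius_class (planar_corolla p.1 p.2 v).
  by rewrite (bigD1 v isT) /= /term /planar_decoration coef_monomial (negbTE vE) !mul0r.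
apply/existsP; apply: contraNT qp => /existsPn h; apply/eqP.
have /and3P[pl QN QT] := Pp; have /and3P[pl' QN' QT'] := Pq.
have [|sE QE] := planar_corolla_inj pl' pl QN' QN QT' QT;
    last by case: (q) (p) sE QE => [? ?] [? ?] /= -> ->.
by move=> v; apply/eqP; have := h v; rewrite negbK.
Qed.

End DualFunctional.

(** * The dual dg operad as a sum of complexes of bracketings *)

Section Assembly.
Variables (k : fieldType) (n : nat) (n1 : (1 < n)%N).
Implicit Types (s : {perm 'I_n}) (T : tree n) (X Q : {set {set 'I_n}}) (L : {set 'I_n}).

Lemma tset_edges T : setT |: edges (tset T) = tset T.
Proof. by rewrite setD1K //; have [h _ _] := is_treeP (tsetP T). Qed.

Lemma bracketing_edges T s : planar T s -> bracketing s (edges (tset T)).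
Proof.
have [_ h2 h3] := is_treeP (tsetP T).
move=> /forall_inP pl; apply/bracketingP; split=> [D|D E].
  by rewrite 2!inE => /andP[DT DX]; rewrite DT h2 ?pl.
rewrite 2!inE => /andP[_ DX]; rewrite 2!inE => /andP[_ EX].
by apply/or3P; case: (h3 D E DX EX) => h; [constructor 1|constructor 2|constructor 3].
Qed.

Lemma bracketing_tree s X : bracketing s X ->
  exists T, planar T s /\ edges (tset T) = X.
Proof.
move=> /bracketingP[h1 h2].
have XT : setT \notin X by apply/negP => /h1[]; rewrite eqxx.
have tr : is_tree (setT |: X).
  apply/and3P; split; first exact: setU11.
    apply/forall_inP => D /setU1P[->|/h1[]//].
    by rewrite cardsT card_ord.
  apply/forall_inP => D DX; apply/forall_inP => E EX.
  case/setU1P: EX => [->|EX]; first by rewrite subsetT.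
  case/setU1P: DX => [->|DX]; first by rewrite subsetT orbT.
  exact: h2.
exists (exist (fun Y => is_true (is_tree Y)) _ tr); rewrite /planar /tset /=.
split; last by rewrite /edges setU1K.
apply/forall_inP => D /setU1P[->|/h1[]//].
by apply/convexP => a b c; rewrite !inE.
Qed.

Lemma edges_contract T (e : edge T) : edges (tset (contract_tree e)) = edges (tset T) :\ eset e.
Proof. by rewrite tset_contract /edges !setDDl setUC. Qed.

Lemma coef_zero (I : finType) m : coef (0 : MAss k I) m = 0.
Proof. by rewrite -(scale0r (0 : MAss k I)) coef_scale mul0r. Qed.

(** Contraction preserves the order and the colours of the leaves, so the
differential acts separately for each of them, as the simplicial coboundary. *)
Lemma dC_planar (chi : cochain (MAss k) n) (H : {perm 'I_n} -> {set 'I_n} -> {set {set 'I_n}} -> k)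
    T s Q m : (forall T', in_dual (chi T')) ->
  (forall T' s' L, planar T' s' -> dual_coef (chi T') s' L = H s' L (edges (tset T'))) ->
  planar T s -> setT \notin Q ->
  coef (dC chi (planar_decoration k T s Q)) m =
  colour_coef (fun s' L => coboundary (H s' L) (edges (tset T))) s (leaf_colours Q) m.
Proof.
move=> chiD chiH pl QT; rewrite /dC coef_big.
transitivity (\sum_(e : edge T) sgn k (edges (tset T)) (eset e) *
    colour_coef (fun s' L => H s' L (edges (tset T) :\ eset e)) s (leaf_colours Q) m).
  apply: eq_bigr => e _; rewrite coef_scale contract_planar // (dual_planar n1 (chiD _)) //.
  congr (_ * _); rewrite /colour_coef; case: eqP => _; rewrite chiH ?edges_contract //.
    exact: planar_contract.
  by rewrite planar_rev planar_contract.
pose f A := sgn k (edges (tset T)) A *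
    colour_coef (fun s' L => H s' L (edges (tset T) :\ A)) s (leaf_colours Q) m.
transitivity (\sum_(A in edges (tset T)) f A); first by exact: esym (big_sub (edges (tset T)) f).
by rewrite /f /colour_coef; case: eqP.
Qed.

(** A tree is determined by its inner edges, so that the value of chi at a planar
monomial is a function of this set. *)
Definition family_coef (chi : cochain (MAss k) n) s L X : k :=
  if [pick T : tree n | (edges (tset T) == X) && planar T s] is Some T
  then dual_coef (chi T) s L else 0.

Lemma family_coefE chi T s L : planar T s ->
  dual_coef (chi T) s L = family_coef chi s L (edges (tset T)).
Proof.
move=> pl; rewrite /family_coef; case: pickP => [T' /andP[/eqP TT _]|/(_ T)];
    last by rewrite eqxx pl.
suff -> : T' = T by [].
by apply: val_inj; rewrite -/(tset T') -/(tset T) -tset_edges TT tset_edges.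
Qed.

Lemma planar_singletons T s L : planar T s -> planar_colouring T (s, singletons L).
Proof.
move=> pl; rewrite /planar_colouring /= pl (setT_notin_singletons n1) andbT /=.
by apply/subsetP => D /imsetP[l _ ->]; rewrite inE imset_f ?orbT.
Qed.

(** The primitives found for each order and colouring of the leaves assemble into
one cochain. *)
Lemma MAss_exact_at j : j != 0 -> exact_at (MAss k) n j.
Proof.
move=> j0 phi phiC cocycle; pose m : int := j - (1 - n%:Z) - 1.
have phiD T : in_dual (phi T) by have [] := phiC T.
have phi0 T x : #|edges (tset T)|%:Z != m -> phi T x = 0 by move=> h; have [_] := phiC T; exact.
have ex (p : {perm 'I_n} * {set 'I_n}) : exists G : {set {set 'I_n}} -> k,
    (forall X, G X != 0 -> bracketing p.1 X /\ #|X|%:Z = m - 1) /\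
    forall X, bracketing p.1 X -> coboundary G X = family_coef phi p.1 p.2 X.
  apply: (bracketing_exact (s := p.1) (m := m)) => // [|X|X /bracketing_tree[T [pl <-]]].
  - by rewrite /m; lia.
  - rewrite /family_coef; case: pickP => [T /andP[/eqP <- pl]|_]; last by rewrite eqxx.
    rewrite /dual_coef => n0; split; first exact: bracketing_edges.
    by apply/eqP; apply: contraNT n0 => /phi0->; rewrite coef_zero.
  - have QT := setT_notin_singletons n1 p.2.
    have := dC_planar unit_class phiD (fun T s L => @family_coefE phi T s L) pl QT.
    by rewrite cocycle coef_zero singletonsK /colour_coef eqxx.
have {ex} [G GP] := fin_all_exists ex.
pose psi : cochain (MAss k) n := fun T => dual_of (T := T) (fun s L => G (s, L) (edges (tset T))).
have psiD T : in_dual (psi T) by exact: dual_of_in_dual.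
have psiH T s L : planar T s -> dual_coef (psi T) s L = G (s, L) (edges (tset T)).
  move=> pl; rewrite /dual_coef /psi (dual_of_planar _ _ (planar_singletons L pl)) /=.
  by rewrite /colour_coef eqxx singletonsK.
exists psi; split=> [T|T].
  split=> [//|cT x]; apply: coef_inj => w; rewrite coef_dual_of coef_zero big1 // => p _.
  have G0 q : G q (edges (tset T)) = 0.
    apply: contraNeq cT => /(proj1 (GP q))[_ ->]; apply/eqP; rewrite /m; lia.
  by rewrite /colour_coef !G0 if_same mulr0.
apply: multilinear_ext => [||c].
- by apply: dC_multilinear => T'; have [] := psiD T'.
- by have [] := phiD T.
have [s [Q [pl _ QT cE]]] := planar_corolla_surj c.
have -> : (fun v => monomial k (c v)) = planar_decoration k T s Q.
  by apply: functional_extensionality_dep => v; rewrite cE.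
apply: coef_inj => w; apply: (etrans (dC_planar (H := fun s L => G (s, L)) w psiD psiH pl QT)).
rewrite (dual_planar n1 (phiD T)) // /colour_coef; case: eqP => _.
  rewrite family_coefE //; have [_ dG] := GP (s, leaf_colours Q).
  by have := dG _ (bracketing_edges pl).
have pl' : planar T (rev_perm s) by rewrite planar_rev.
rewrite family_coefE //; have [_ dG] := GP (rev_perm s, ~: leaf_colours Q).
by have := dG _ (bracketing_edges pl').
Qed.

End Assembly.

Theorem corollary3p24 (k : fieldType) : koszul (MAss k).
Proof. by move=> n j n1 j0; apply: MAss_exact_at. Qed.
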